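(* Let $A\in\mathbb R^{m\times n}$ be nonzero and $b\in\mathbb R^m$. Suppose that $\mathbb E_{T\in\overline\Omega}[TT^\top]$ and $\mathbb E_{S\in\Omega}[SS^\top]$ are positive definite and that $\Omega$ is finite. Let $\eta\in(0,2)$, $z^0\in b+\mathrm{Range}(A)$, $x^0\in\mathrm{Range}(A^\top)$, and let $\{x^k\}_{k\ge0}$ be the sequence generated by the stochastic extended iterative method with adaptive step-sizes and relaxation parameters $\eta,\zeta$ (defined in the context). If $\zeta\in(0,\frac12]$ and $\epsilon\in(0,\frac{\zeta}{1-\zeta})$, or $\zeta\in(\frac12,2)$ and $\epsilon\in(0,1]$, then for every $k\ge1$ (with $\rho_z>0$, so that the quotient below is defined) $$\mathbb E\left[\|x^k-A^\dagger b\|_2^2\right]\le \rho^k\left(\|x^0-A^\dagger b\|_2^2+\frac{d_{\zeta,\epsilon}\,\lambda_{\max}(H)}{\Lambda_{\min}\max\left\{\left|1-\frac{\rho_x}{\rho_z}\right|,\frac1k\right\}}\,\|z^0-b_{\mathrm{Range}(A)^\perp}\|_2^2\right).$$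
   Context: Setting. $(\Omega,\mathcal F,P)$ and $(\overline\Omega,\overline{\mathcal F},\overline P)$ are probability spaces whose elements are real matrices: each $S\in\Omega$ has $m$ rows, each $T\in\overline\Omega$ has $n$ rows. $A^\dagger$ is the Moore–Penrose pseudoinverse; $b_{\mathrm{Range}(A)^\perp}$ is the orthogonal projection of $b$ onto $\mathrm{Range}(A)^\perp$; $\|\cdot\|_2$ is the Euclidean norm for vectors and the spectral norm for matrices. $\sigma_{\min}(\cdot)$ and $\lambda_{\min}(\cdot)$ denote the smallest nonzero singular value and the smallest nonzero eigenvalue; $\lambda_{\max}(\cdot)$ the largest eigenvalue. Algorithm (stochastic extended iterative method with adaptive step-sizes). Parameters $\eta,\zeta\in(0,2)$; deterministic initial points $z^0\in b+\mathrm{Range}(A)$, $x^0\in\mathrm{Range}(A^\top)$. At each step $k=0,1,2,\dots$ draw $T_k\in\overline\Omega$ according to $\overline P$ and $S_k\in\Omega$ according to $P$ (all draws mutually independent) and set $$z^{k+1}=z^k-\mu_kAT_kT_k^\top A^\top z^k,\qquad x^{k+1}=x^k-\alpha_kA^\top S_kS_k^\top\left(Ax^k-(b-z^{k+1})\right),$$ where $$\mu_k=(2-\eta)\frac{\|T_k^\top A^\top z^k\|_2^2}{\|AT_kT_k^\top A^\top z^k\|_2^2}\ \text{ if } T_k^\top A^\top z^k\ne0,\qquad \mu_k=0\ \text{ otherwise},$$ $$\alpha_k=(2-\zeta)\frac{\|S_k^\top(Ax^k-(b-z^{k+1}))\|_2^2}{\|A^\top S_kS_k^\top(Ax^k-(b-z^{k+1}))\|_2^2}\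 \text{ if } S_k^\top(Ax^k-(b-z^{k+1}))\ne0,\qquad \alpha_k=0\ \text{ otherwise}.$$ Constants. $$H=\mathbb E_{S\in\Omega}\left[\frac{SS^\top}{\|A^\top S\|_2^2}\right],\qquad \overline H=\mathbb E_{T\in\overline\Omega}\left[\frac{TT^\top}{\|AT\|_2^2}\right]$$ (assumed finite; terms with zero denominator are read as $0$), $$\rho_z=1-\eta(2-\eta)\sigma_{\min}^2(\overline H^{\frac12}A^\top),\qquad \Lambda_{\min}=\inf_{S\in\Omega,\ A^\top S\ne0}\lambda_{\min}\left(\frac{A^\top SS^\top A}{\|A^\top S\|_2^2}\right),$$ $$c_{\zeta,\epsilon}=\begin{cases}(2-\zeta)\left(1-(1+\epsilon)(1-\zeta)\right),&\zeta\in(0,1),\\(2-\zeta)\left(1+(1-\epsilon)(\zeta-1)\right),&\zeta\in[1,2),\end{cases}$$ $$d_{\zeta,\epsilon}=\begin{cases}(2-\zeta)\left(1+(\epsilon^{-1}+1)(1-\zeta)\right),&\zeta\in(0,1),\\(2-\zeta)\left(1+(\epsilon^{-1}-1)(\zeta-1)\right),&\zeta\in[1,2),\end{cases}$$ $$\rho_x=1-c_{\zeta,\epsilon}\,\sigma_{\min}^2(H^{\frac12}A),\qquad \rho=\max\{\rho_z,\rho_x\}.$$ *)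

(* Defs.v *)
From HB Require Import structures.
From mathcomp Require Import all_boot all_order all_algebra.
From mathcomp Require Import finmap.
From mathcomp Require Import all_classical all_reals all_analysis.

Set Implicit Arguments.
Unset Strict Implicit.
Unset Printing Implicit Defensive.

Import Order.TTheory GRing.Theory Num.Theory.

Local Open Scope classical_set_scope.
Local Open Scope ring_scope.

Section linear_algebra.
Context {R : realType}.

(* MathComp-Analysis norms a matrix by the maximum of its entries, so the
   Euclidean norm is defined here. *)
Definition l2norm n (v : 'cV[R]_n) : R := Num.sqrt (\sum_i v i 0 ^+ 2).

Definition dotcv n (u v : 'cV[R]_n) : R := (u^T *m v) 0 0.

Definition possemidef n (M : 'M[R]_n) : Prop :=
  M^T = M /\ forall v : 'cV[R]_n, 0 <= dotcv v (M *m v).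

Definition posdef n (M : 'M[R]_n) : Prop :=
  M^T = M /\ forall v : 'cV[R]_n, v != 0 -> 0 < dotcv v (M *m v).

(* [sup] and [inf] range over the finite spectrum of a matrix. *)
Definition lambda_max n (M : 'M[R]_n) : R := sup [set a | eigenvalue M a].

Definition lambda_min n (M : 'M[R]_n) : R :=
  inf [set a | eigenvalue M a /\ a != 0].

(* For p < q the q x q matrix B^T B contributes the singular value 0 in excess
   of the min(p, q) usual ones; this affects neither the largest nor the
   smallest nonzero singular value. *)
Definition singular_value p q (B : 'M[R]_(p, q)) (s : R) : Prop :=
  0 <= s /\ eigenvalue (B^T *m B) (s ^+ 2).

(* The spectral norm of a matrix with no columns is sup set0 = 0. *)
Definition spectral_norm p q (B : 'M[R]_(p, q)) : R :=
  sup [set s | singular_value B s].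

Definition sigma_min p q (B : 'M[R]_(p, q)) : R :=
  inf [set s | singular_value B s /\ s != 0].

Definition psd_sqrt n (M : 'M[R]_n) : 'M[R]_n :=
  xget 0 [set X | possemidef X /\ X *m X = M].

(* The Moore-Penrose pseudoinverse; MathComp's [pinvmx] only satisfies
   A X A = A. *)
Definition is_mp_inverse m n (A : 'M[R]_(m, n)) (X : 'M[R]_(n, m)) : Prop :=
  [/\ A *m X *m A = A, X *m A *m X = X,
      (A *m X)^T = A *m X & (X *m A)^T = X *m A].

Definition mp_inverse m n (A : 'M[R]_(m, n)) : 'M[R]_(n, m) :=
  xget 0 [set X | is_mp_inverse A X].

Definition mxrange m n (A : 'M[R]_(m, n)) : set 'cV[R]_m :=
  range (fun x : 'cV[R]_n => A *m x).

Definition orthc n (V : set 'cV[R]_n) : set 'cV[R]_n :=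
  [set v | forall w, V w -> dotcv v w = 0].

Definition orthproj n (V : set 'cV[R]_n) (b : 'cV[R]_n) : 'cV[R]_n :=
  xget 0 [set v | V v /\ orthc V (b - v)].

End linear_algebra.

Section iteration.
Context {R : realType} {m n : nat}.
Variables (A : 'M[R]_(m, n)) (b : 'cV[R]_m) (eta zeta : R).

Definition z_step q (T : 'M[R]_(n, q)) (z : 'cV[R]_m) : 'cV[R]_m :=
  let g := T^T *m A^T *m z in
  let u := A *m T *m T^T *m A^T *m z in
  let mu := if g != 0 then (2 - eta) * (l2norm g ^+ 2 / l2norm u ^+ 2) else 0 in
  z - mu *: u.

(* [z] stands for the already updated iterate z^{k+1}. *)
Definition x_step p (S : 'M[R]_(m, p)) (z : 'cV[R]_m) (x : 'cV[R]_n) :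
    'cV[R]_n :=
  let g := S^T *m (A *m x - (b - z)) in
  let u := A^T *m S *m S^T *m (A *m x - (b - z)) in
  let alpha :=
    if g != 0 then (2 - zeta) * (l2norm g ^+ 2 / l2norm u ^+ 2) else 0 in
  x - alpha *: u.

Fixpoint z_iter (q : nat -> nat) (T : forall k, 'M[R]_(n, q k))
    (z0 : 'cV[R]_m) (k : nat) : 'cV[R]_m :=
  if k is k'.+1 then z_step (T k') (z_iter T z0 k') else z0.

Fixpoint x_iter (q : nat -> nat) (T : forall k, 'M[R]_(n, q k))
    (p : nat -> nat) (S : forall k, 'M[R]_(m, p k))
    (z0 : 'cV[R]_m) (x0 : 'cV[R]_n) (k : nat) : 'cV[R]_n :=
  if k is k'.+1
  then x_step (S k') (z_iter T z0 k'.+1) (x_iter T S z0 x0 k')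
  else x0.

End iteration.

Section probability.
Context {R : realType} {d : measure_display} {U : measurableType d}.
Variable P : probability U R.

Definition mx_integrable m n (X : U -> 'M[R]_(m, n)) : Prop :=
  forall i j, P.-integrable [set: U] (fun w => (X w i j)%:E).

Definition mx_expectation m n (X : U -> 'M[R]_(m, n)) : 'M[R]_(m, n) :=
  \matrix_(i, j) fine ('E_P [fun w => X w i j])%E.

(* The number of columns of a random matrix may depend on the outcome, hence
   the dependent type of [S] below. *)
Definition gram m (p : U -> nat) (S : forall w, 'M[R]_(m, p w)) :
    U -> 'M[R]_m :=
  fun w => S w *m (S w)^T.

(* S S^T / ||B S||_2^2; it is 0 when B S = 0, since 0^-1 = 0. *)
Definition scaled_gram l m (B : 'M[R]_(l, m)) (p : U -> nat)
    (S : forall w, 'M[R]_(m, p w)) : U -> 'M[R]_m :=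
  fun w => spectral_norm (B *m S w) ^- 2 *: gram S w.

Definition mutually_independent (I : choiceType) (F : I -> set_system U) :
    Prop :=
  forall (J : {fset I}) (E : I -> set U),
    (forall i, i \in J -> F i (E i)) ->
    P (\bigcap_(i in [set` J]) E i) = (\prod_(i <- J) P (E i))%E.

(* The sigma-algebras generated by the draws of two sequences of random
   elements: index [inl k] for the k-th element of the first one, [inr k] for
   the k-th element of the second one. *)
Definition draws_sigma d1 (U1 : measurableType d1) d2 (U2 : measurableType d2)
    (f : nat -> {RV P >-> U1}) (g : nat -> {RV P >-> U2}) (i : nat + nat) :
    set_system U :=
  match i with
  | inl k => g_sigma_algebra_preimage (f k)
  | inr k => g_sigma_algebra_preimage (g k)
  end.

End probability.

Section constants.
Context {R : realType} {m n : nat}.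
Variable A : 'M[R]_(m, n).

Definition rho_z (eta : R) (Hbar : 'M[R]_n) : R :=
  1 - eta * (2 - eta) * sigma_min (psd_sqrt Hbar *m A^T) ^+ 2.

Definition Lambda_min (U : Type) (p : U -> nat)
    (S : forall w, 'M[R]_(m, p w)) : R :=
  inf [set lambda_min (spectral_norm (A^T *m S w) ^- 2 *:
                         (A^T *m S w *m (S w)^T *m A))
      | w in [set w | A^T *m S w != 0]].

Definition c_const (zeta eps : R) : R :=
  if zeta < 1 then (2 - zeta) * (1 - (1 + eps) * (1 - zeta))
  else (2 - zeta) * (1 + (1 - eps) * (zeta - 1)).

Definition d_const (zeta eps : R) : R :=
  if zeta < 1 then (2 - zeta) * (1 + (eps^-1 + 1) * (1 - zeta))
  else (2 - zeta) * (1 + (eps^-1 - 1) * (zeta - 1)).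

Definition rho_x (zeta eps : R) (H : 'M[R]_m) : R :=
  1 - c_const zeta eps * sigma_min (psd_sqrt H *m A) ^+ 2.

End constants.

(* Main.v *)
Require Import Defs.
From HB Require Import structures.
From mathcomp Require Import all_boot all_order all_algebra.
From mathcomp Require Import finmap.
From mathcomp Require Import all_classical all_reals all_analysis.
From mathcomp Require Import measurable_realfun complex spectral ring lra.

Set Implicit Arguments.
Unset Strict Implicit.
Unset Printing Implicit Defensive.

Import Order.TTheory GRing.Theory Num.Theory.

Local Open Scope classical_set_scope.
Local Open Scope ring_scope.

(** Write zs for the projection of b onto the orthogonal complement of Range(A)
    and xs = A^+ b, so that A^T zs = 0 and A xs = b - zs. The errors z^k - zs
    and x^k - xs stay in Range(A) and Range(A^T).

    For a fixed draw, the adaptive step-size makes the quadratic in the step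
    collapse ([relaxed_step_sq]): the squared error decreases by the step-size
    times an expression in g = T^T A^T (z - zs), respectively in
    g = S^T A (x - xs) + S^T (z - zs). The step-size ratio |g|^2 / |A^T S g|^2
    is at least 1 / ||A^T S||^2 by definition of the spectral norm, and at most
    1 / (Lambda_min ||A^T S||^2) because g lies in the range of S^T A
    ([step_ratio_bounds]). For z this gives a pure contraction ([z_step_le]).
    For x the perturbation S^T (z - zs) is separated from the main term by
    Young's inequality with parameter eps, which yields the coefficients
    [c_const] and [d_const] ([x_step_le]).

    Both bounds are affine in quadratic forms of the scaled Gram matrix, whose
    mean is H or Hbar. Averaging over one draw therefore gives the factors rho_z
    and rho_x through the smallest nonzero singular value of H^(1/2) A
    ([mean_scaled_gram_sigma_min]); this uses that the kernel of H^(1/2) A is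
    that of A, a consequence of the positive definiteness of E[S S^T]
    ([mean_scaled_gram_kernel]). The perturbation contributes lambda_max(H).

    Since each draw is independent of the earlier ones, these averages may be
    taken with the previous iterates frozen: the joint law of past and draw is
    a product measure and Tonelli's theorem applies ([integral_freeze],
    [le_integral_draw]). The mean squared errors then satisfy
      Z (k+1) <= rho_z Z k,   X (k+1) <= rho_x X k + gamma Z (k+1),
    with gamma = d lambda_max(H) / Lambda_min. Unfolding the second recursion
    produces the sum of rho_x^(k-1-i) rho_z^(i+1) over i < k, which is estimated
    in two ways to obtain the maximum in the statement ([geom_conv_le]).

    The spectral facts about real symmetric matrices all come from an
    orthonormal basis of eigenvectors ([orthonormal_eigenbasis]). *)

(** * The Euclidean inner product *)

Section dot_product.
Context {R : realType}.

Lemma dotcvE n (u v : 'cV[R]_n) : dotcv u v = \sum_i u i 0 * v i 0.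
Proof. by rewrite /dotcv mxE; apply: eq_bigr => i _; rewrite mxE. Qed.

Lemma dotcvC n (u v : 'cV[R]_n) : dotcv u v = dotcv v u.
Proof. by rewrite !dotcvE; apply: eq_bigr => i _; rewrite mulrC. Qed.

Lemma dotcvDl n (u v w : 'cV[R]_n) : dotcv (u + v) w = dotcv u w + dotcv v w.
Proof. by rewrite /dotcv linearD mulmxDl mxE. Qed.

Lemma dotcvDr n (u v w : 'cV[R]_n) : dotcv u (v + w) = dotcv u v + dotcv u w.
Proof. by rewrite /dotcv mulmxDr mxE. Qed.

Lemma dotcvZl n a (u v : 'cV[R]_n) : dotcv (a *: u) v = a * dotcv u v.
Proof. by rewrite /dotcv linearZ/= -scalemxAl mxE. Qed.

Lemma dotcvZr n a (u v : 'cV[R]_n) : dotcv u (a *: v) = a * dotcv u v.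
Proof. by rewrite /dotcv -scalemxAr mxE. Qed.

Lemma dotcvNl n (u v : 'cV[R]_n) : dotcv (- u) v = - dotcv u v.
Proof. by rewrite -scaleN1r dotcvZl mulN1r. Qed.

Lemma dotcvNr n (u v : 'cV[R]_n) : dotcv u (- v) = - dotcv u v.
Proof. by rewrite -scaleN1r dotcvZr mulN1r. Qed.

Lemma dotcv0l n (v : 'cV[R]_n) : dotcv 0 v = 0.
Proof. by rewrite -(scale0r 0) dotcvZl mul0r. Qed.

Lemma dotcv_ge0 n (v : 'cV[R]_n) : 0 <= dotcv v v.
Proof. by rewrite dotcvE sumr_ge0// => i _; rewrite -expr2 sqr_ge0. Qed.

Lemma dotcv_eq0 n (v : 'cV[R]_n) : (dotcv v v == 0) = (v == 0).
Proof.
apply/eqP/eqP => [|->]; last by rewrite dotcv0l.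
rewrite dotcvE => /eqP; rewrite psumr_eq0 => [/allP v0|i _]; last first.
  by rewrite -expr2 sqr_ge0.
apply/colP => i; have := v0 i (mem_index_enum _).
by rewrite mxE /= mulf_eq0 orbb => /eqP.
Qed.

Lemma dotcv_gt0 n (v : 'cV[R]_n) : (0 < dotcv v v) = (v != 0).
Proof. by rewrite lt0r dotcv_eq0 dotcv_ge0 andbT. Qed.

Lemma l2norm_sq n (v : 'cV[R]_n) : l2norm v ^+ 2 = dotcv v v.
Proof.
rewrite /l2norm sqr_sqrtr ?dotcvE; last by rewrite sumr_ge0// => i _; rewrite sqr_ge0.
by apply: eq_bigr => i _; rewrite expr2.
Qed.

Lemma dotcv_mulr m n (A : 'M[R]_(m, n)) u v :
  dotcv u (A *m v) = dotcv (A^T *m u) v.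
Proof. by rewrite /dotcv trmx_mul trmxK mulmxA. Qed.

Lemma dotcv_mull m n (A : 'M[R]_(m, n)) u v :
  dotcv (A *m u) v = dotcv u (A^T *m v).
Proof. by rewrite dotcv_mulr trmxK. Qed.

Lemma dotcv_gram m n (A : 'M[R]_(m, n)) v :
  dotcv v (A *m A^T *m v) = dotcv (A^T *m v) (A^T *m v).
Proof. by rewrite -mulmxA dotcv_mulr. Qed.

Lemma dotcv_sqB n (u v : 'cV[R]_n) :
  dotcv (u - v) (u - v) = dotcv u u - 2 * dotcv u v + dotcv v v.
Proof.
rewrite dotcvDl !dotcvDr !dotcvNl !dotcvNr (dotcvC v u); ring.
Qed.

Lemma dotcv_sqD n (u v : 'cV[R]_n) :
  dotcv (u + v) (u + v) = dotcv u u + 2 * dotcv u v + dotcv v v.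
Proof. by rewrite dotcvDl !dotcvDr (dotcvC v u); ring. Qed.

Lemma young_dotcv n (u v : 'cV[R]_n) eps : 0 < eps ->
  2 * `|dotcv u v| <= eps * dotcv u u + eps^-1 * dotcv v v.
Proof.
move=> e0; have e0' : eps != 0 by rewrite gt_eqF.
have := dotcv_ge0 (eps *: u - v); have := dotcv_ge0 (eps *: u + v).
rewrite dotcv_sqB dotcv_sqD !dotcvZl !dotcvZr => h1 h2.
rewrite -(ler_pM2l e0) mulrDr mulVKf// mulrCA.
by case: (ler0P (dotcv u v)) => _; lra.
Qed.

End dot_product.

(** * The real spectral theorem *)

Section real_spectral.
Context {R : realType}.

(** Over the complex numbers an eigenvector x + iy exists. Symmetry forces the
    eigenvalue to be real, so x and y are both eigenvectors or zero. *)
Lemma symmetric_real_eigenvector n (M : 'M[R]_n) : (0 < n)%N -> M^T = M ->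
  exists a (v : 'cV[R]_n), v != 0 /\ M *m v = a *: v.
Proof.
move=> n0 Msym; pose C : numClosedFieldType := R[i].
have [a /eigenvalueP[v va v0]] :=
  eigenvalue_closed (map_mx (real_complex R) M : 'M[C]_n) n0.
pose x : 'cV[R]_n := \col_i complex.Re (v 0 i).
pose y : 'cV[R]_n := \col_i complex.Im (v 0 i).
have ReM (c d : R[i]) : complex.Re (c * d) =
    complex.Re c * complex.Re d - complex.Im c * complex.Im d by case: c; case: d.
have ImM (c d : R[i]) : complex.Im (c * d) =
    complex.Im c * complex.Re d + complex.Re c * complex.Im d.
  by case: c => ? ?; case: d => ? ? /=; rewrite addrC.
have sumRe (F : 'I_n -> R[i]) : complex.Re (\sum_i F i) = \sum_i complex.Re (F i).
  by apply: (big_morph (@complex.Re R)) => // -[? ?] [].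
have sumIm (F : 'I_n -> R[i]) : complex.Im (\sum_i F i) = \sum_i complex.Im (F i).
  by apply: (big_morph (@complex.Im R)) => // -[? ?] [].
have Mx : M *m x = complex.Re a *: x - complex.Im a *: y.
  apply/colP => i; have /matrixP/(_ 0 i) := va.
  rewrite !mxE => /(congr1 (@complex.Re R)); rewrite sumRe.
  rewrite ReM => <-; apply: eq_bigr => j _; rewrite !mxE -[in LHS]Msym mxE.
  by rewrite ReM /= mulr0 subr0 mulrC.
have My : M *m y = complex.Im a *: x + complex.Re a *: y.
  apply/colP => i; have /matrixP/(_ 0 i) := va.
  rewrite !mxE => /(congr1 (@complex.Im R)); rewrite sumIm.
  rewrite ImM => <-; apply: eq_bigr => j _; rewrite !mxE -[in LHS]Msym mxE.
  by rewrite ImM /= mulr0 addr0 mulrC.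
have xy0 : (x != 0) || (y != 0).
  rewrite -negb_and; apply: contra v0 => /andP[/eqP x0 /eqP y0].
  apply/eqP/rowP => i; move/colP : x0 => /(_ i); move/colP : y0 => /(_ i).
  by rewrite !mxE => Im0 Re0; apply/eqP; rewrite eq_complex Im0 Re0 eqxx.
(* <M x, y> = <x, M y> reads Im a * (|x|^2 + |y|^2) = 0. *)
have Ima0 : complex.Im a = 0.
  have : dotcv (M *m x) y = dotcv x (M *m y) by rewrite dotcv_mull Msym.
  rewrite Mx My dotcvDl dotcvNl !dotcvDr !dotcvZl !dotcvZr => h.
  have := dotcv_ge0 x; have := dotcv_ge0 y.
  have : 0 < dotcv x x + dotcv y y.
    by case/orP : xy0; rewrite -dotcv_gt0 => ?;
      [apply: ltr_pwDl|apply: ltr_wpDl]; rewrite // dotcv_ge0.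
  move=> s0 _ _; have /eqP : complex.Im a * (dotcv x x + dotcv y y) = 0 by lra.
  by rewrite mulf_eq0 (gt_eqF s0) orbF => /eqP.
case/orP : xy0 => ?; [exists (complex.Re a), x|exists (complex.Re a), y].
  by rewrite Mx Ima0 scale0r subr0.
by rewrite My Ima0 scale0r add0r.
Qed.

(** Two distinct unit vectors are exchanged by the reflection in the hyperplane
    orthogonal to their difference. *)
Lemma householder_reflection n (e u : 'cV[R]_n) : dotcv e e = 1 -> dotcv u u = 1 ->
  exists W : 'M[R]_n, [/\ W^T = W, W *m W = 1%:M & W *m e = u].
Proof.
move=> e1 u1; have [<-|neu] := eqVneq e u.
  by exists 1%:M; rewrite trmx1 !mul1mx.
pose f := e - u; pose c := 2 / dotcv f f.
have f0 : dotcv f f != 0 by rewrite dotcv_eq0 subr_eq0.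
have ffE : f *m (f^T *m f) = dotcv f f *: f.
  by rewrite [f^T *m f]mx11_scalar mul_mx_scalar.
have feE : f *m (f^T *m e) = dotcv f e *: f.
  by rewrite [f^T *m e]mx11_scalar mul_mx_scalar.
exists (1%:M - c *: (f *m f^T)); split.
- by rewrite linearB/= linearZ/= trmx1 trmx_mul trmxK.
- rewrite mulmxBl mul1mx mulmxBr mulmx1 -!scalemxAl -scalemxAr.
  rewrite mulmxA -(mulmxA f) ffE -scalemxAl !scalerA.
  have -> : c * (c * dotcv f f) = c + c by rewrite /c; field.
  by rewrite scalerDl opprB addrK subrK.
- rewrite mulmxBl mul1mx -scalemxAl -mulmxA feE scalerA.
  suff -> : c * dotcv f e = 1 by rewrite scale1r /f opprB addrCA subrr addr0.
  have : dotcv f f = 2 * dotcv f e.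
    rewrite /f dotcv_sqB dotcvDl dotcvNl e1 u1 (dotcvC u); ring.
  move=> h; rewrite /c {}h in f0 *; field.
  by apply: contra_neq f0 => ->; rewrite mulr0.
Qed.

(** Moving a unit eigenvector onto the first basis vector by a reflection splits
    off a 1 x 1 block, since symmetry clears both the first row and the first
    column. *)
Lemma symmetric_diagonalization n (M : 'M[R]_n) : M^T = M ->
  exists (W : 'M[R]_n) (d : 'rV[R]_n),
    W^T *m W = 1%:M /\ M = W *m diag_mx d *m W^T.
Proof.
elim: n M => [|n IHn]; first by move=> M _; exists 0, 0; split; apply/matrixP => -[].
rewrite -[n.+1]/(1 + n)%N => M Msym.
have [a [v [v0 Mv]]] := symmetric_real_eigenvector (ltn0Sn n) Msym.
pose e : 'cV[R]_(1 + n) := col_mx 1%:M 0.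
pose u := (Num.sqrt (dotcv v v))^-1 *: v.
have e1 : dotcv e e = 1.
  by rewrite /dotcv tr_col_mx mul_row_col trmx1 mul1mx mulmx0 addr0 mxE.
have u1 : dotcv u u = 1.
  rewrite dotcvZl dotcvZr mulrA -invfM -expr2 sqr_sqrtr ?dotcv_ge0//.
  by rewrite mulVf// dotcv_eq0.
have Mu : M *m u = a *: u by rewrite -scalemxAr Mv !scalerA mulrC.
have [W [Wsym WW We]] := householder_reflection e1 u1.
pose N : 'M[R]_(1 + n) := W *m M *m W.
have Nsym : N^T = N by rewrite /N !trmx_mul Wsym Msym mulmxA.
have Ne : N *m e = a *: e.
  by rewrite /N -mulmxA We -mulmxA Mu -scalemxAr -We mulmxA WW mul1mx.
have NE : N = block_mx a%:M 0 0 (drsubmx N).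
  have := Ne; rewrite -[N]submxK /e mul_block_col !mulmx1 !mulmx0 !addr0.
  rewrite scale_col_mx scaler0 scalemx1 => /eq_col_mx[ulE dlE].
  rewrite ulE dlE block_mxKdr; congr block_mx.
  have := Nsym; rewrite -[N in RHS]submxK -[N in LHS]submxK tr_block_mx.
  by case/eq_block_mx => _ <- _ _; rewrite dlE trmx0.
have drsym : (drsubmx N)^T = drsubmx N by rewrite trmx_drsub Nsym.
have [V [d [VV NV]]] := IHn _ drsym.
pose V1 : 'M[R]_(1 + n) := block_mx 1%:M 0 0 V.
exists (W *m V1), (row_mx a%:M d : 'rV_(1 + n)); split.
  rewrite trmx_mul Wsym mulmxA -(mulmxA _ W W) WW mulmx1.
  rewrite /V1 tr_block_mx !trmx0 trmx1 mulmx_block !mulmx0 !mul0mx !mul1mx.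
  by rewrite !addr0 !add0r VV -scalar_mx_block.
have -> : M = W *m N *m W.
  by rewrite /N !mulmxA WW mul1mx -mulmxA WW mulmx1.
suff -> : N = V1 *m diag_mx (row_mx a%:M d : 'rV_(1 + n)) *m V1^T.
  by rewrite trmx_mul Wsym !mulmxA.
rewrite NE NV /V1 diag_mx_row tr_block_mx !trmx0 trmx1 !mulmx_block.
rewrite !mulmx0 !mul0mx !mul1mx !mulmx1 !addr0 !add0r !mul0mx.
suff -> : diag_mx (a%:M : 'rV_1) = a%:M by [].
by apply/matrixP => i j; rewrite !ord1 !mxE.
Qed.

(** The basis is given by vectors and Parseval's identity rather than by an
    orthogonal matrix: quadratic forms in M and the inner product become sums
    over the same coordinates, so that inequalities between them follow
    termwise from inequalities between eigenvalues. *)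
Lemma orthonormal_eigenbasis n (M : 'M[R]_n) : M^T = M ->
  exists (f : 'I_n -> 'cV[R]_n) (d : 'I_n -> R),
    [/\ forall i, M *m f i = d i *: f i,
        forall u v, dotcv u v = \sum_i dotcv (f i) u * dotcv (f i) v &
        forall a, eigenvalue M a <-> exists i, a = d i].
Proof.
move=> Msym; have [W [d [WtW ME]]] := symmetric_diagonalization Msym.
have WWt : W *m W^T = 1%:M by exact: mulmx1C.
have fE i v : dotcv (col i W) v = (W^T *m v) i 0.
  by rewrite dotcvE mxE; apply: eq_bigr => j _; rewrite !mxE.
have Mf i : M *m col i W = d 0 i *: col i W.
  rewrite colE ME !mulmxA -(mulmxA _ W^T W) WtW mulmx1 -mulmxA scalemxAr.
  congr (_ *m _); apply/colP => j; rewrite mul_diag_mx !mxE.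
  by case: eqVneq => [->|]; rewrite ?mulr0.
have parseval u v : dotcv u v = \sum_i dotcv (col i W) u * dotcv (col i W) v.
  rewrite -[v in LHS]mul1mx -WWt -mulmxA dotcv_mulr dotcvE.
  by apply: eq_bigr => i _; rewrite !fE.
exists (fun i => col i W), (d 0); split => // a; split.
  move=> /eigenvalueP[v va v0].
  have MvT : M *m v^T = a *: v^T by rewrite -[in LHS]Msym -trmx_mul va linearZ.
  (* An eigenvector has a nonzero coordinate, which identifies its eigenvalue. *)
  have [i vi] : exists i, dotcv (col i W) v^T != 0.
    apply/not_existsP => h; case/negP: v0; rewrite -(inj_eq trmx_inj) trmx0.
    by rewrite -dotcv_eq0 parseval big1// => i _; have /negP/negPn/eqP-> := h i; rewrite mul0r.
  exists i; have : dotcv (col i W) (M *m v^T) = dotcv (M *m col i W) v^T.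
    by rewrite dotcv_mulr Msym.
  by rewrite MvT Mf dotcvZl dotcvZr => /(mulIf vi).
move=> [i ->]; apply/eigenvalueP; exists (col i W)^T.
  by rewrite -[in LHS]Msym -trmx_mul Mf linearZ.
rewrite -(inj_eq trmx_inj) trmx0 trmxK -dotcv_eq0 fE mxE.
suff -> : \sum_j W^T i j * col i W j 0 = (W^T *m W) i i.
  by rewrite WtW mxE eqxx oner_eq0.
by rewrite mxE; apply: eq_bigr => j _; rewrite !mxE.
Qed.

Lemma psd_sqrtP n (M : 'M[R]_n) : possemidef M ->
  (psd_sqrt M)^T = psd_sqrt M /\ psd_sqrt M *m psd_sqrt M = M.
Proof.
move=> [Msym Mge0].
suff : [set X | possemidef X /\ X *m X = M] (psd_sqrt M) by case=> -[].
have [W [d [WtW ME]]] := symmetric_diagonalization Msym.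
pose s : 'rV[R]_n := \row_i Num.sqrt (d 0 i).
(* d_i is the value of the quadratic form of M at the i-th column of W. *)
have d0 i : 0 <= d 0 i.
  have := Mge0 (W *m delta_mx i 0).
  rewrite ME -!mulmxA dotcv_mull (mulmxA W^T) WtW mul1mx (mulmxA W^T W) WtW mul1mx.
  rewrite dotcvE (bigD1 i)//= big1 ?addr0 => [|j ji].
    rewrite !mxE !eqxx mul1r (bigD1 i)//= big1 ?addr0 => [|j ji]; rewrite !mxE.
      by rewrite !eqxx mulr1n mulr1.
    by rewrite (negbTE ji) mulr0.
  by rewrite mxE (negbTE ji) mul0r.
apply: (@xgetPex _ _ [set X | possemidef X /\ X *m X = M]).
exists (W *m diag_mx s *m W^T); split; last first.
  rewrite !mulmxA -(mulmxA _ W^T W) WtW mulmx1 ME; congr (_ *m _).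
  rewrite -mulmxA mulmx_diag; congr (_ *m diag_mx _).
  by apply/rowP => i; rewrite !mxE -expr2 sqr_sqrtr.
split; first by rewrite !trmx_mul trmxK tr_diag_mx mulmxA.
move=> v; rewrite -mulmxA -mulmxA dotcv_mulr dotcvE sumr_ge0// => i _.
rewrite mul_diag_mx !mxE mulrCA mulr_ge0 ?sqrtr_ge0//.
by rewrite -expr2 sqr_ge0.
Qed.

End real_spectral.

(** * Extremal eigenvalues and singular values *)

Section extreme_eigenvalues.
Context {R : realType}.

Lemma has_ubound_indexed n (F : 'I_n -> R) (A : set R) :
  (forall a, A a -> exists i, a = F i) -> has_ubound A.
Proof.
move=> AF; exists (\sum_i `|F i|) => a /AF[i ->].
rewrite (bigD1 i)//= (le_trans (ler_norm _))// lerDl.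
by rewrite sumr_ge0.
Qed.

Lemma sup_nonneg (A : set R) : (forall a, A a -> 0 <= a) -> 0 <= sup A.
Proof.
move=> A0; have [Asup|/sup_out->//] := pselect (has_sup A).
have [[a Aa] Aub] := Asup.
by rewrite (le_trans (A0 _ Aa))// ub_le_sup.
Qed.

Lemma inf_nonneg (A : set R) : (forall a, A a -> 0 <= a) -> 0 <= inf A.
Proof.
move=> A0; have [->|/set0P An0] := eqVneq A set0; first by rewrite inf0.
exact: lb_le_inf.
Qed.

(** Nonpositive entries are skipped, which makes the induction immediate. *)
Lemma positive_lower_bound (s : seq R) :
  exists2 c, 0 < c & forall a, a \in s -> 0 < a -> c <= a.
Proof.
elim: s => [|b s [c c0 cs]]; first by exists 1.
have [b0|b0] := ltP 0 b; last first.
  exists c => // a; rewrite inE => /predU1P[->|]; last exact: cs.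
  by move/lt_le_trans => /(_ _ b0); rewrite ltxx.
exists (Num.min b c); rewrite ?lt_min ?b0// => a.
rewrite inE ge_min => /predU1P[-> _|as_ a0]; first by rewrite lexx.
by rewrite (cs _ as_ a0) orbT.
Qed.

Lemma inf_finite_gt0 (A : set R) : A !=set0 -> finite_set A ->
  (forall a, A a -> 0 < a) -> 0 < inf A.
Proof.
move=> A0 /finite_seqP[s As] Apos; have [c c0 cs] := positive_lower_bound s.
rewrite (lt_le_trans c0)// lb_le_inf// => a Aa.
by rewrite cs ?Apos//; move: Aa; rewrite As.
Qed.

Lemma lambda_max_rayleigh n (M : 'M[R]_n) v : M^T = M ->
  dotcv v (M *m v) <= lambda_max M * dotcv v v.
Proof.
move=> Msym; have [f [d [Mf parseval eigE]]] := orthonormal_eigenbasis Msym.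
rewrite !parseval mulr_sumr ler_sum// => i _.
rewrite dotcv_mulr Msym Mf dotcvZl mulrCA ler_wpM2r -?expr2 ?sqr_ge0//.
apply: ub_le_sup; last by apply/eigE; exists i.
by apply: (@has_ubound_indexed _ d) => a /eigE.
Qed.

Lemma gram_eigenvalue_ge0 p q (B : 'M[R]_(p, q)) a :
  eigenvalue (B^T *m B) a -> 0 <= a.
Proof.
move=> /eigenvalueP[v va v0].
have : 0 <= dotcv v^T (a *: v^T).
  by rewrite -linearZ/= -va !trmx_mul trmxK -mulmxA dotcv_mulr trmxK dotcv_ge0.
rewrite dotcvZr pmulr_lge0//.
by rewrite dotcv_gt0 -(inj_eq trmx_inj) trmxK trmx0.
Qed.

Lemma gram_sym p q (B : 'M[R]_(p, q)) : (B^T *m B)^T = B^T *m B.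
Proof. by rewrite trmx_mul trmxK. Qed.

Lemma singular_valueE p q (B : 'M[R]_(p, q)) a :
  eigenvalue (B^T *m B) a -> singular_value B (Num.sqrt a).
Proof.
by move=> ea; split; rewrite ?sqrtr_ge0// sqr_sqrtr// (gram_eigenvalue_ge0 ea).
Qed.

Lemma spectral_norm_ge0 p q (B : 'M[R]_(p, q)) : 0 <= spectral_norm B.
Proof. by apply: sup_nonneg => s []. Qed.

Lemma le_spectral_norm p q (B : 'M[R]_(p, q)) v :
  dotcv (B *m v) (B *m v) <= spectral_norm B ^+ 2 * dotcv v v.
Proof.
have [f [d [Mf parseval eigE]]] := orthonormal_eigenbasis (gram_sym B).
rewrite dotcv_mull mulmxA !parseval mulr_sumr ler_sum// => i _.
rewrite dotcv_mulr gram_sym Mf dotcvZl mulrCA ler_wpM2r -?expr2 ?sqr_ge0//.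
have edi : eigenvalue (B^T *m B) (d i) by apply/eigE; exists i.
rewrite -[d i]sqr_sqrtr ?(gram_eigenvalue_ge0 edi)//.
rewrite lerXn2r ?nnegrE ?sqrtr_ge0 ?spectral_norm_ge0//.
apply: ub_le_sup; last exact: singular_valueE.
apply: (@has_ubound_indexed _ (Num.sqrt \o d)) => a [a0 /eigE[j aE]].
by exists j; rewrite /= -aE sqrtr_sqr ger0_norm.
Qed.

Lemma spectral_norm_eq0 p q (B : 'M[R]_(p, q)) : spectral_norm B = 0 -> B = 0.
Proof.
move=> B0; apply/matrixP => i j; rewrite mxE.
have := le_spectral_norm B (delta_mx j 0).
rewrite B0 expr0n mul0r => h.
have /eqP : dotcv (B *m delta_mx j 0) (B *m delta_mx j 0) = 0.
  by apply/eqP; rewrite eq_le h dotcv_ge0.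
by rewrite dotcv_eq0 -colE => /eqP/colP/(_ i); rewrite !mxE.
Qed.

Lemma sigma_min_ge0 p q (B : 'M[R]_(p, q)) : 0 <= sigma_min B.
Proof. by apply: inf_nonneg => s [[]]. Qed.

(** A vector orthogonal to the kernel of B has no component along the eigenvectors
    of B^T B with eigenvalue 0; on the others the eigenvalue is at least
    sigma_min(B)^2. *)
Lemma sigma_min_le p q (B : 'M[R]_(p, q)) (e : 'cV[R]_q) :
  (forall v, B *m v = 0 -> dotcv v e = 0) ->
  sigma_min B ^+ 2 * dotcv e e <= dotcv (B *m e) (B *m e).
Proof.
move=> eker; have [f [d [Mf parseval eigE]]] := orthonormal_eigenbasis (gram_sym B).
rewrite dotcv_mull mulmxA !parseval mulr_sumr ler_sum// => i _.
rewrite (dotcv_mulr _ (f i)) gram_sym Mf dotcvZl.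
have [di0|di0] := eqVneq (d i) 0.
  rewrite (eker (f i)) ?(mulr0, mul0r)//; apply/eqP; rewrite -dotcv_eq0 dotcv_mull mulmxA.
  by rewrite Mf di0 scale0r dotcvC dotcv0l.
rewrite [leRHS]mulrCA ler_wpM2r -?expr2 ?sqr_ge0//.
have edi : eigenvalue (B^T *m B) (d i) by apply/eigE; exists i.
have di_ge0 := gram_eigenvalue_ge0 edi.
rewrite -[d i]sqr_sqrtr// lerXn2r ?nnegrE ?sqrtr_ge0 ?sigma_min_ge0//.
apply: ge_inf; first by exists 0 => s [[]].
by split; [exact: singular_valueE|rewrite sqrtr_eq0 -ltNge lt0r di0].
Qed.

Lemma lambda_min_gt0 p q (B : 'M[R]_(p, q)) : B != 0 -> 0 < lambda_min (B^T *m B).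
Proof.
move=> B0; have [f [d [Mf parseval eigE]]] := orthonormal_eigenbasis (gram_sym B).
apply: inf_finite_gt0.
- apply/set0P/negP => /eqP h.
  have d0 i : d i = 0.
    apply/eqP/negP => /negP di0; suff : set0 (d i) by [].
    by rewrite -h; split => //; apply/eigE; exists i.
  case/negP : B0; apply/eqP/matrixP => i j; rewrite mxE.
  suff : B *m delta_mx j 0 = 0 :> 'cV_p by rewrite -colE => /colP/(_ i); rewrite !mxE.
  apply/eqP; rewrite -dotcv_eq0 dotcv_mull mulmxA parseval big1// => k _.
  by rewrite (dotcv_mulr _ (f k)) gram_sym Mf d0 scale0r dotcv0l mulr0.
- apply: (@sub_finite_set _ _ (range d)); last exact/finite_image/finite_finset.
  by move=> a [/eigE[i ->] _]; exists i.
- by move=> a [/gram_eigenvalue_ge0 a0 an0]; rewrite lt0r an0.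
Qed.

(** In eigencoordinates this is lambda_min * d_i <= d_i^2, which also holds for
    d_i = 0. *)
Lemma lambda_min_le p q (B : 'M[R]_(p, q)) v :
  lambda_min (B^T *m B) * dotcv (B *m v) (B *m v) <=
  dotcv (B^T *m B *m v) (B^T *m B *m v).
Proof.
have [f [d [Mf parseval eigE]]] := orthonormal_eigenbasis (gram_sym B).
rewrite dotcv_mull mulmxA !parseval mulr_sumr ler_sum// => i _.
rewrite (dotcv_mulr _ (f i)) gram_sym Mf dotcvZl.
have [->|di0] := eqVneq (d i) 0; first by rewrite !(mulr0, mul0r).
have edi : eigenvalue (B^T *m B) (d i) by apply/eigE; exists i.
have lmin : lambda_min (B^T *m B) <= d i.
  by apply: ge_inf; first by exists 0 => s [/gram_eigenvalue_ge0].
have := gram_eigenvalue_ge0 edi.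
set y := dotcv _ _ => d0; rewrite (_ : d i * y * (d i * y) = d i * (y * (d i * y))); last by ring.
by rewrite ler_wpM2r// mulrCA mulr_ge0// -expr2 sqr_ge0.
Qed.

End extreme_eigenvalues.

(** * Pseudoinverse, ranges and projections *)

Section pseudoinverse.
Context {R : realType}.

Lemma row_free_gram_unit r n (G : 'M[R]_(r, n)) : row_free G -> G *m G^T \in unitmx.
Proof.
move=> Gfree; rewrite -row_free_unit; apply: inj_row_free => v vGG.
have vG0 : G^T *m v^T = 0.
  apply/eqP; rewrite -dotcv_eq0 dotcv_mull trmxK mulmxA.
  have -> : G *m G^T *m v^T = (v *m (G *m G^T))^T by rewrite !trmx_mul trmxK.
  by rewrite vGG trmx0 dotcvC dotcv0l.
apply: (row_free_inj Gfree); rewrite mul0mx.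
by apply: (can_inj trmxK); rewrite trmx_mul vG0 trmx0.
Qed.

(** A full-rank factorization A = C G gives the explicit pseudoinverse
    G^T (G G^T)^-1 (C^T C)^-1 C^T. *)
Lemma mp_inverseP m n (A : 'M[R]_(m, n)) : is_mp_inverse A (mp_inverse A).
Proof.
apply: (@xgetPex _ _ [set X | is_mp_inverse A X]).
have [r [C [G [AE Gfree Cfree]]]] : exists r (C : 'M[R]_(m, r)) (G : 'M[R]_(r, n)),
    [/\ A = C *m G, row_free G & row_free C^T].
  exists (\rank A), (col_base A), (row_base A); split.
  - by rewrite mulmx_base.
  - exact: row_base_free.
  - by rewrite /row_free mxrank_tr; exact: col_base_full.
have Gu := row_free_gram_unit Gfree.
have Cu := row_free_gram_unit Cfree; rewrite trmxK in Cu.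
pose P := invmx (G *m G^T); pose Q := invmx (C^T *m C).
have Psym : P^T = P by rewrite /P trmx_inv trmx_mul trmxK.
have Qsym : Q^T = Q by rewrite /Q trmx_inv trmx_mul trmxK.
exists (G^T *m P *m (Q *m C^T)).
have AX : A *m (G^T *m P *m (Q *m C^T)) = C *m Q *m C^T.
  rewrite AE -!mulmxA; congr (_ *m _).
  by rewrite (mulmxA G) (mulmxA (G *m _)) mulmxV// mul1mx.
have XA : G^T *m P *m (Q *m C^T) *m A = G^T *m P *m G.
  rewrite AE -!mulmxA; do 2 congr (_ *m _).
  by rewrite (mulmxA C^T) (mulmxA Q) mulVmx// mul1mx.
split.
- rewrite AX AE -!mulmxA; congr (_ *m _).
  by rewrite (mulmxA C^T) (mulmxA Q) mulVmx// mul1mx.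
- rewrite XA -!mulmxA; do 2 congr (_ *m _).
  by rewrite (mulmxA G) (mulmxA (G *m _)) mulmxV// mul1mx.
- by rewrite AX !trmx_mul trmxK Qsym mulmxA.
- by rewrite XA !trmx_mul trmxK Psym mulmxA.
Qed.

Lemma orthc_mxrange m n (A : 'M[R]_(m, n)) v : orthc (mxrange A) v <-> A^T *m v = 0.
Proof.
split=> [h|Av w [x _ <-]]; last by rewrite dotcv_mulr Av dotcv0l.
by apply/eqP; rewrite -dotcv_eq0 dotcv_mull trmxK h//; exists (A^T *m v).
Qed.

Lemma mp_inverse_normal_equation m n (A : 'M[R]_(m, n)) (b : 'cV[R]_m) :
  A^T *m (b - A *m mp_inverse A *m b) = 0.
Proof.
have [AXA _ AXsym _] := mp_inverseP A.
rewrite mulmxBr -AXsym (mulmxA A^T) -trmx_mul AXA.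
exact: subrr.
Qed.

(** The right-hand side satisfies the defining property of the projection, and
    two vectors with that property have a difference orthogonal to itself. *)
Lemma orthproj_range_orthc m n (A : 'M[R]_(m, n)) (b : 'cV[R]_m) :
  orthproj (orthc (mxrange A)) b = b - A *m mp_inverse A *m b.
Proof.
set V := orthc _; set w := b - _.
have Vw : V w by apply/orthc_mxrange; exact: mp_inverse_normal_equation.
have Vbw : orthc V (b - w).
  move=> v /orthc_mxrange Av; rewrite opprB addrC subrK.
  by rewrite -mulmxA dotcv_mull Av dotcvC dotcv0l.
clearbody w.
have [Vp Vbp] : [set v | V v /\ orthc V (b - v)] (orthproj V b).
  by apply: (@xgetPex _ _ [set v | V v /\ orthc V (b - v)]); exists w.
apply/eqP; rewrite -subr_eq0 -dotcv_eq0; apply/eqP.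
have Vd : V (orthproj V b - w).
  by move=> u ru; rewrite dotcvDl dotcvNl Vp// Vw// subrr.
have {1}-> : orthproj V b - w = (b - w) - (b - orthproj V b) :> 'cV_m.
  by rewrite opprB addrCA [b - w - b]addrAC subrr add0r.
by rewrite dotcvDl dotcvNl Vbw// Vbp// subrr.
Qed.

(** From A^+ = A^+ A A^+ and the symmetry of A^+ A. *)
Lemma mp_inverse_range m n (A : 'M[R]_(m, n)) (b : 'cV[R]_m) :
  mxrange A^T (mp_inverse A *m b).
Proof.
have [_ XAX _ XAsym] := mp_inverseP A.
exists ((mp_inverse A)^T *m mp_inverse A *m b) => //.
by rewrite !mulmxA -trmx_mul XAsym XAX.
Qed.

Lemma mxrangeD m n (A : 'M[R]_(m, n)) u v :
  mxrange A u -> mxrange A v -> mxrange A (u + v).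
Proof. by move=> [x _ <-] [y _ <-]; exists (x + y); rewrite ?mulmxDr. Qed.

Lemma mxrangeZ m n (A : 'M[R]_(m, n)) a u : mxrange A u -> mxrange A (a *: u).
Proof. by move=> [x _ <-]; exists (a *: x); rewrite -?scalemxAr. Qed.

Lemma mxrangeB m n (A : 'M[R]_(m, n)) u v :
  mxrange A u -> mxrange A v -> mxrange A (u - v).
Proof. by move=> ru /(mxrangeZ (- 1)); rewrite scaleN1r; exact: mxrangeD. Qed.

End pseudoinverse.

(** * One step for a fixed draw *)

Section one_step.
Context {R : realType}.

Lemma scaled_gram_quad d (U : measurableType d) l m (B : 'M[R]_(l, m)) (p : U -> nat)
    (S : forall w, 'M[R]_(m, p w)) w v :
  dotcv v (scaled_gram B S w *m v) =
  (spectral_norm (B *m S w) ^+ 2)^-1 * dotcv ((S w)^T *m v) ((S w)^T *m v).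
Proof. by rewrite /scaled_gram -scalemxAl dotcvZr dotcv_gram. Qed.

(** The bound on B carries over to its transpose. *)
Lemma spectral_norm_gram_le p q (B : 'M[R]_(p, q)) v :
  (spectral_norm B ^+ 2)^-1 * dotcv (B^T *m v) (B^T *m v) <= dotcv v v.
Proof.
have [B0|B0] := eqVneq (spectral_norm B) 0.
  by rewrite B0 expr0n invr0 mul0r dotcv_ge0.
have s0 : 0 < spectral_norm B ^+ 2 by rewrite exprn_gt0// lt0r B0 spectral_norm_ge0.
set u := B^T *m v.
(* Expand |v - t B B^T v|^2 >= 0 with t = 1 / ||B||^2. *)
have := dotcv_ge0 (v - (spectral_norm B ^+ 2)^-1 *: (B *m u)).
rewrite dotcv_sqB !dotcvZr !dotcvZl dotcv_mulr -/u => h.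
have := le_spectral_norm B u.
set N := spectral_norm B ^+ 2 in s0 h *; set x := dotcv u u in h *.
move=> k; have : N^-1 * (N^-1 * dotcv (B *m u) (B *m u)) <= N^-1 * x.
  rewrite ler_wpM2l ?invr_ge0 ?(ltW s0)//.
  by rewrite -(ler_pM2l s0) mulrA divff ?mul1r// gt_eqF.
lra.
Qed.

(** The step-size mu is chosen so that the second-order term mu^2 |C^T g|^2 equals
    mu * beta * |g|^2, of the same shape as the first-order one. When C^T g = 0 the step is void
    and mu = 0, because division by 0 gives 0. *)
Lemma relaxed_step_sq l p (C : 'M[R]_(p, l)) (e : 'cV[R]_l) (g : 'cV[R]_p) beta :
  let mu := beta * (dotcv g g / dotcv (C^T *m g) (C^T *m g)) in
  dotcv (e - mu *: (C^T *m g)) (e - mu *: (C^T *m g)) =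
  dotcv e e - mu * (2 * dotcv (C *m e) g - beta * dotcv g g).
Proof.
move=> mu; rewrite dotcv_sqB !dotcvZr !dotcvZl dotcv_mulr trmxK /mu.
have [->|Cg0] := eqVneq (C^T *m g) 0.
  rewrite dotcv0l invr0 !mulr0 !mul0r !mulr0.
  by rewrite addr0.
move: Cg0; rewrite -dotcv_eq0; set N := dotcv (C^T *m g) _ => N0; field.
exact: N0.
Qed.

Lemma spectral_norm_sq_gt0 p q (B : 'M[R]_(p, q)) :
  B != 0 -> 0 < spectral_norm B ^+ 2.
Proof.
move=> B0; rewrite exprn_gt0// lt0r spectral_norm_ge0 andbT.
by apply: contra B0 => /eqP/spectral_norm_eq0->.
Qed.

Lemma gram_scale p q (C : 'M[R]_(p, q)) k : 0 <= k ->
  k *: (C^T *m C) = (Num.sqrt k *: C)^T *m (Num.sqrt k *: C).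
Proof.
move=> k0; rewrite [(_ *: C)^T]linearZ/= -scalemxAl -scalemxAr scalerA.
by rewrite -expr2 sqr_sqrtr.
Qed.

Lemma scaled_lambda_min_gt0 p q (C : 'M[R]_(p, q)) k :
  0 < k -> C != 0 -> 0 < lambda_min (k *: (C^T *m C)).
Proof.
move=> k0 C0; rewrite gram_scale ?(ltW k0)// lambda_min_gt0//.
by rewrite scaler_eq0 negb_or C0 sqrtr_eq0 -ltNge k0.
Qed.

(** The lower bound on the ratio is the spectral norm inequality for C^T. The
    upper one applies [lambda_min_le] to the matrix sqrt k C: it needs g in the
    range of C, on which C^T is bounded below. Comparing the two bounds gives
    L <= 1. *)
Lemma step_ratio_bounds l p (C : 'M[R]_(p, l)) (e : 'cV[R]_l) (L : R) :
  let k := (spectral_norm C^T ^+ 2)^-1 in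
  let g := C *m e in
  let r := dotcv g g / dotcv (C^T *m g) (C^T *m g) in
  C != 0 -> g != 0 -> 0 < L -> L <= lambda_min (k *: (C^T *m C)) ->
  [/\ k <= r, r <= L^-1 * k & L <= 1].
Proof.
move=> k g r C0 g0 L0 Lle.
have s0 : 0 < spectral_norm C^T ^+ 2.
  by rewrite spectral_norm_sq_gt0// -(inj_eq trmx_inj) trmxK trmx0.
have k0 : 0 < k by rewrite invr_gt0.
have gg : 0 < dotcv g g by rewrite dotcv_gt0.
have sqrtk : Num.sqrt k * Num.sqrt k = k by rewrite -expr2 sqr_sqrtr// ltW.
have lower : L * dotcv g g <= k * dotcv (C^T *m g) (C^T *m g).
  have := lambda_min_le (Num.sqrt k *: C) e.
  rewrite -gram_scale ?(ltW k0)// -!scalemxAl -/g -mulmxA -/g !dotcvZl !dotcvZr.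
  rewrite (mulrA (Num.sqrt k)) sqrtk mulrCA ler_pM2l// => h.
  by apply: le_trans h; rewrite ler_wpM2r// ltW.
have upper : k * dotcv (C^T *m g) (C^T *m g) <= dotcv g g.
  rewrite -[leRHS]mul1r -(mulVf (lt0r_neq0 s0)) -mulrA ler_pM2l//.
  exact: le_spectral_norm.
have Cg0 : 0 < dotcv (C^T *m g) (C^T *m g).
  by rewrite -(pmulr_rgt0 _ k0) (lt_le_trans _ lower)// mulr_gt0.
split.
- by rewrite /r ler_pdivlMr.
- by rewrite /r ler_pdivrMr// -mulrA -(ler_pM2l L0) [leRHS]mulrA divff ?mul1r// gt_eqF.
- by rewrite -(ler_pM2r gg) mul1r (le_trans lower).
Qed.


(** As A^T zs = 0, the update only sees the error: g = T^T A^T (z - zs). *)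
Lemma z_step_le m n (A : 'M[R]_(m, n)) eta q (T : 'M[R]_(n, q))
    (z zs : 'cV[R]_m) : 0 < eta < 2 -> A^T *m zs = 0 ->
  l2norm (z_step A eta T z - zs) ^+ 2 <= l2norm (z - zs) ^+ 2 -
    eta * (2 - eta) * ((spectral_norm (A *m T) ^+ 2)^-1 *
      dotcv (T^T *m (A^T *m (z - zs))) (T^T *m (A^T *m (z - zs)))).
Proof.
move=> eta02 Azs; have /andP[eta0 eta2] := eta02; set e := z - zs.
pose C := T^T *m A^T; pose g := C *m e.
have CT : C^T = A *m T by rewrite /C trmx_mul !trmxK.
have gE : T^T *m A^T *m z = g.
  by rewrite /g /C /e mulmxBr -[X in _ - X]mulmxA Azs mulmx0 subr0.
have -> : T^T *m (A^T *m e) = g by rewrite /g /C mulmxA.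
have -> : z_step A eta T z - zs =
    e - ((2 - eta) * (dotcv g g / dotcv (C^T *m g) (C^T *m g))) *: (C^T *m g).
  have uE : A *m T *m T^T *m A^T *m z = C^T *m g by rewrite CT -gE !mulmxA.
  rewrite /z_step gE uE !l2norm_sq addrAC.
  congr (_ - _ *: _); case: ifPn => // /negPn/eqP->.
  by rewrite dotcv0l mul0r mulr0.
rewrite !l2norm_sq relaxed_step_sq -/g -CT lerD2l lerN2.
have [->|g0] := eqVneq g 0; first by rewrite !dotcv0l !(mul0r, mulr0).
have C0 : C != 0 by apply: contra_neq g0; rewrite /g => ->; rewrite mul0mx.
have k0 : 0 < (spectral_norm C^T ^+ 2)^-1.
  by rewrite invr_gt0 spectral_norm_sq_gt0// -(inj_eq trmx_inj) trmxK trmx0.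
have [kr _ _] := step_ratio_bounds C0 g0 (scaled_lambda_min_gt0 k0 C0) (lexx _).
rewrite -/g in kr; set k := (_ ^+ 2)^-1 in kr *; set r := _ / _ in kr *.
have -> : (2 - eta) * r * (2 * dotcv g g - (2 - eta) * dotcv g g) =
  eta * (2 - eta) * (r * dotcv g g) by ring.
have ee : 0 <= eta * (2 - eta) by apply: mulr_ge0; lra.
by rewrite ler_wpM2l ?ler_wpM2r ?dotcv_ge0.
Qed.

Definition admissible (zeta eps : R) : Prop :=
  (0 < zeta <= 1 / 2) && (0 < eps < zeta / (1 - zeta)) \/
  (1 / 2 < zeta < 2) && (0 < eps <= 1).

Lemma admissible_bounds zeta eps : admissible zeta eps ->
  [/\ 0 < zeta < 2, 0 < eps & 1 <= zeta -> eps <= 1].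
Proof.
by case=> /andP[/andP[? ?] /andP[? ?]]; split => // *; lra.
Qed.

(** The sign is where the restriction on eps for small zeta comes from:
    c_const >= 0 amounts to eps (1 - zeta) <= zeta when zeta < 1. The upper bound
    reduces to zeta (2 - zeta) <= 1. *)
Lemma c_const_ge0 (zeta eps : R) : admissible zeta eps ->
  0 <= c_const zeta eps <= 1.
Proof.
rewrite /c_const => -[/andP[/andP[z0 z1] /andP[e0 e1]]|/andP[/andP[z0 z1] /andP[e0 e1]]].
  have z2 : zeta < 1 by lra.
  have h : eps * (1 - zeta) < zeta by rewrite -ltr_pdivlMr//; lra.
  have h1 : 0 < eps * (1 - zeta) by rewrite mulr_gt0//; lra.
  rewrite z2; apply/andP; split; first by apply: mulr_ge0; lra.
  nra.
case: ifPn => [z2|]; last rewrite -leNgt => z2.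
  have h : 0 <= eps * (1 - zeta) <= 1 - zeta.
    by rewrite mulr_ge0 ?ler_piMl//; lra.
  apply/andP; split; first by apply: mulr_ge0; lra.
  nra.
have h : 0 <= eps * (zeta - 1) <= zeta - 1.
  by rewrite mulr_ge0 ?ler_piMl//; lra.
apply/andP; split; first by apply: mulr_ge0; lra.
nra.
Qed.

Lemma d_const_ge0 (zeta eps : R) : admissible zeta eps -> 0 <= d_const zeta eps.
Proof.
rewrite /d_const => /admissible_bounds[/andP[z0 z2] e0 e1]; have := e0; rewrite -invr_gt0 => ei0.
case: ifPn => [z1|].
  have h : 0 <= eps^-1 * (1 - zeta) by apply: mulr_ge0; lra.
  by apply: mulr_ge0; lra.
rewrite -leNgt => z1; have ei1 : 1 <= eps^-1 by rewrite invr_ge1 ?unitfE ?gt_eqF ?e1.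
have h : 0 <= (eps^-1 - 1) * (zeta - 1) by apply: mulr_ge0; lra.
by apply: mulr_ge0; lra.
Qed.

(** The inner product of a := S^T A e and s := S^T w is absorbed by Young's
    inequality with parameter eps; this is where [c_const] and [d_const] come
    from. *)
Lemma relaxed_young (zeta eps : R) p (a s : 'cV[R]_p) : 0 < zeta < 2 -> 0 < eps ->
  c_const zeta eps * dotcv a a - d_const zeta eps * dotcv s s <=
  (2 - zeta) * (2 * dotcv a (a + s) - (2 - zeta) * dotcv (a + s) (a + s)).
Proof.
move=> /andP[z0 z2] e0; have := young_dotcv a s e0.
rewrite dotcvDr dotcv_sqD /c_const /d_const.
set aa := dotcv a a; set ss := dotcv s s; set as_ := dotcv a s => Y.
have [Y1 Y2] : 2 * as_ <= eps * aa + eps^-1 * ss /\ - (2 * as_) <= eps * aa + eps^-1 * ss.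
  split; apply: le_trans Y; rewrite -?mulrN ler_pM2l//.
    exact: ler_norm.
  by rewrite -normrN ler_norm.
case: ifPn => [z1|]; last rewrite -leNgt => z1; rewrite -!mulrA -mulrBr ler_pM2l; try lra.
  have : (1 - zeta) * (2 * as_) <= (1 - zeta) * (eps * aa + eps^-1 * ss).
    by rewrite ler_wpM2l//; lra.
  lra.
have : (zeta - 1) * - (2 * as_) <= (zeta - 1) * (eps * aa + eps^-1 * ss).
  by rewrite ler_wpM2l//; lra.
lra.
Qed.

(** The coefficient of |a|^2 is bounded with the lower estimate of the step-size
    ratio and that of |s|^2 with the upper one; this needs both coefficients to
    be nonnegative. *)
Lemma x_step_le m n (A : 'M[R]_(m, n)) (b : 'cV[R]_m) (zeta eps L : R) p
    (S : 'M[R]_(m, p)) (z zs : 'cV[R]_m) (x xs : 'cV[R]_n) :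
  admissible zeta eps ->
  A *m xs = b - zs -> mxrange A (z - zs) -> 0 < L ->
  (A^T *m S != 0 ->
   L <= lambda_min (spectral_norm (A^T *m S) ^- 2 *: (A^T *m S *m S^T *m A))) ->
  l2norm (x_step A b zeta S z x - xs) ^+ 2 <= l2norm (x - xs) ^+ 2 -
    c_const zeta eps * ((spectral_norm (A^T *m S) ^+ 2)^-1 *
      dotcv (S^T *m (A *m (x - xs))) (S^T *m (A *m (x - xs)))) +
    d_const zeta eps / L * ((spectral_norm (A^T *m S) ^+ 2)^-1 *
      dotcv (S^T *m (z - zs)) (S^T *m (z - zs))).
Proof.
move=> zeps Axs [y _ yE] L0 Lle; set e := x - xs; set w := z - zs.
have [zeta02 eps0 eps1] := admissible_bounds zeps.
have /andP[c0 _] := c_const_ge0 zeps.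
have d0 := d_const_ge0 zeps.
pose C := S^T *m A; pose a := C *m e; pose s := C *m y; pose g := C *m (e + y).
have CT : C^T = A^T *m S by rewrite /C trmx_mul !trmxK.
have sE : S^T *m w = s by rewrite /w -yE /s /C mulmxA.
have gE : S^T *m (A *m x - (b - z)) = g.
  have -> : A *m x - (b - z) = A *m (e + y).
    rewrite mulmxDr mulmxBr Axs yE; apply/colP => i; rewrite !mxE; ring.
  by rewrite /g /C mulmxA.
have gas : g = a + s by rewrite /g mulmxDr.
have -> : S^T *m (A *m e) = a by rewrite /a /C mulmxA.
rewrite sE.
have -> : x_step A b zeta S z x - xs =
    e - ((2 - zeta) * (dotcv g g / dotcv (C^T *m g) (C^T *m g))) *: (C^T *m g).
  have uE : A^T *m S *m S^T *m (A *m x - (b - z)) = C^T *m g.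
    by rewrite CT -gE !mulmxA.
  rewrite /x_step gE uE !l2norm_sq addrAC.
  congr (_ - _ *: _); case: ifPn => // /negPn/eqP->.
  by rewrite dotcv0l mul0r mulr0.
rewrite !l2norm_sq relaxed_step_sq -/a -CT -[leRHS]addrA lerD2l lerNl opprD opprK.
have Y := relaxed_young a s zeta02 eps0; rewrite -gas in Y.
have [C0|C0] := eqVneq C 0.
  have [-> ->] : a = 0 /\ s = 0 by rewrite /a /s C0 !mul0mx.
  by rewrite /g C0 !mul0mx !dotcv0l !(mul0r, mulr0, subr0).
have k0 : 0 < (spectral_norm C^T ^+ 2)^-1.
  by rewrite invr_gt0 spectral_norm_sq_gt0// -(inj_eq trmx_inj) trmxK trmx0.
have CT0 : A^T *m S != 0 by rewrite -CT -(inj_eq trmx_inj) trmxK trmx0.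
have {}Lle : L <= lambda_min ((spectral_norm C^T ^+ 2)^-1 *: (C^T *m C)).
  by have := Lle CT0; rewrite -CT /C !mulmxA.
set k := (_ ^+ 2)^-1 in k0 Lle *; set aa := dotcv a a in Y *; set ss := dotcv s s in Y *.
have aa0 : 0 <= aa by exact: dotcv_ge0.
have ss0 : 0 <= ss by exact: dotcv_ge0.
have Li0 : 0 <= L^-1 by rewrite invr_ge0 ltW.
set c := c_const _ _ in c0 Y *; set D := d_const _ _ in d0 Y *.
have [g0|g0] := eqVneq g 0.
  (* The step is void although a and s = - a may be nonzero. Young's inequality
     bounds c |a|^2 by D |s|^2, and L <= 1 allows to divide the latter by L. *)
  have sa : s = - a by apply/eqP; rewrite -addr_eq0 addrC -gas g0.
  have ssaa : ss = aa by rewrite /ss sa dotcvNl dotcvNr opprK.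
  rewrite g0 dotcv0l dotcvC dotcv0l !(mul0r, mulr0, subr0) ssaa in Y *.
  have [a0|a0] := eqVneq a 0; first by rewrite /aa a0 dotcv0l !mulr0 subr0.
  have [_ _ L1] := step_ratio_bounds C0 a0 L0 Lle.
  have Li1 : 1 <= L^-1 by rewrite invr_ge1 ?unitfE ?gt_eqF.
  have h1 : k * (c * aa - D * aa) <= 0 by rewrite pmulr_rle0.
  have h2 : 0 <= (L^-1 - 1) * (D * (k * aa)).
    by rewrite mulr_ge0 ?subr_ge0// mulr_ge0// mulr_ge0// ltW.
  lra.
have [kr rk _] := step_ratio_bounds C0 g0 L0 Lle.
rewrite -/g -/k in kr rk; set r := _ / _ in kr rk *.
have r0 : 0 <= r by rewrite (le_trans (ltW k0)).
have h1 : 0 <= (r - k) * (c * aa) by rewrite mulr_ge0 ?subr_ge0// mulr_ge0.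
have h2 : 0 <= (L^-1 * k - r) * (D * ss) by rewrite mulr_ge0 ?subr_ge0// mulr_ge0.
have := ler_wpM2l r0 Y.
lra.
Qed.

End one_step.

(** * Means of quadratic forms of a random matrix *)

Section mean_quadratic_form.
Context {R : realType} {d : measure_display} {U : measurableType d}.
Variable P : probability U R.

Lemma dotcv_quadE n (M : 'M[R]_n) v :
  dotcv v (M *m v) = \sum_(ij : 'I_n * 'I_n) v ij.1 0 * v ij.2 0 * M ij.1 ij.2.
Proof.
rewrite dotcvE -(pair_bigA _ (fun i j => v i 0 * v j 0 * M i j))/=.
apply: eq_bigr => i _; rewrite mxE mulr_sumr; apply: eq_bigr => j _.
ring.
Qed.

Lemma quad_integrable n (X : U -> 'M[R]_n) v : mx_integrable P X ->
  P.-integrable setT (fun w => (dotcv v (X w *m v))%:E).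
Proof.
move=> iX; under eq_fun do rewrite dotcv_quadE -sumEFin.
apply: integrable_sum => // ij _; under eq_fun do rewrite EFinM.
exact: integrableZl.
Qed.

Lemma quad_integral n (X : U -> 'M[R]_n) v : mx_integrable P X ->
  (\int[P]_w (dotcv v (X w *m v))%:E = (dotcv v (mx_expectation P X *m v))%:E)%E.
Proof.
move=> iX; under eq_integral do rewrite dotcv_quadE -sumEFin.
rewrite integral_sum//; last first.
  by move=> ij; under eq_fun do rewrite EFinM; exact: integrableZl.
rewrite dotcv_quadE -sumEFin; apply: eq_bigr => ij _.
under eq_integral do rewrite EFinM.
rewrite integralZl// [in RHS]EFinM; congr (_ * _)%E.
by rewrite mxE unlock fineK// integrable_fin_num.
Qed.

Lemma mx_expectation_sym n (X : U -> 'M[R]_n) : (forall w, (X w)^T = X w) ->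
  (mx_expectation P X)^T = mx_expectation P X.
Proof.
move=> Xsym; apply/matrixP => i j; rewrite !mxE; congr (fine (expectation _ _)).
by apply/funext => w; rewrite -[in LHS]Xsym mxE.
Qed.

Section scaled_gram_mean.
Context {l m : nat} (B : 'M[R]_(l, m)) (p : U -> nat) (S : forall w, 'M[R]_(m, p w)).
Hypothesis iG : mx_integrable P (scaled_gram B S).
Let H := mx_expectation P (scaled_gram B S).

Lemma scaled_gram_quad_ge0 w v : 0 <= dotcv v (scaled_gram B S w *m v).
Proof.
rewrite scaled_gram_quad mulr_ge0 ?dotcv_ge0//.
by rewrite invr_ge0 exprn_ge0// spectral_norm_ge0.
Qed.

Lemma mean_scaled_gram_psd : possemidef H.
Proof.
split.
  apply: mx_expectation_sym => w.
  by rewrite /scaled_gram /gram linearZ/= trmx_mul trmxK.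
move=> v; rewrite -lee_fin -quad_integral// integral_ge0// => w _.
by rewrite lee_fin scaled_gram_quad_ge0.
Qed.

Lemma scaled_gram_quad_le w e :
  dotcv (B^T *m e) (scaled_gram B S w *m (B^T *m e)) <= dotcv e e.
Proof.
rewrite scaled_gram_quad; apply: le_trans (spectral_norm_gram_le (B *m S w) e).
by rewrite trmx_mul mulmxA.
Qed.

Lemma mean_scaled_gram_le e : dotcv (B^T *m e) (H *m (B^T *m e)) <= dotcv e e.
Proof.
rewrite -lee_fin -quad_integral//.
have -> : ((dotcv e e)%:E = \int[P]_w (dotcv e e)%:E)%E.
  by rewrite integral_cst//= probability_setT mule1.
apply: ge0_le_integral => //.
- by move=> w _; rewrite lee_fin scaled_gram_quad_ge0.
- by have /integrableP[] := quad_integrable (B^T *m e) iG.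
- by move=> w _; rewrite lee_fin scaled_gram_quad_le.
Qed.

Hypothesis igram : mx_integrable P (gram S).
Hypothesis gram_posdef : posdef (mx_expectation P (gram S)).

(** H itself may be singular, since draws with B S = 0 do not contribute to it;
    but such draws do not see the range of B^T either. *)
Lemma mean_scaled_gram_kernel y :
  dotcv (B^T *m y) (H *m (B^T *m y)) = 0 -> B^T *m y = 0.
Proof.
set v := B^T *m y => Hv0; apply: contrapT => /eqP v0.
have /integrableP[mf _] := quad_integrable v iG.
have /integrableP[mg _] := quad_integrable v igram.
have aef : ae_eq P setT (fun w => (dotcv v (scaled_gram B S w *m v))%:E) (cst 0%E).
  apply/ae_eq_integral_abs => //.
  under eq_integral do rewrite gee0_abs ?lee_fin ?scaled_gram_quad_ge0//.
  by rewrite quad_integral// Hv0.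
suff : (\int[P]_w (dotcv v (gram S w *m v))%:E = 0)%E.
  rewrite quad_integral// => -[h].
  by have := gram_posdef.2 _ v0; rewrite h ltxx.
rewrite -(integral0 P setT); apply: ae_eq_integral => //.
apply: filterS aef => w /= /(_ I) [].
rewrite scaled_gram_quad => /eqP; rewrite mulf_eq0 => h _; congr (_%:E).
rewrite dotcv_gram; apply/eqP; case/orP : h => //.
rewrite invr_eq0 sqrf_eq0 => /eqP/spectral_norm_eq0 BS0.
by rewrite /v mulmxA -trmx_mul BS0 trmx0 mul0mx dotcv0l.
Qed.

Lemma mean_scaled_gram_sigma_min e : mxrange B e ->
  sigma_min (psd_sqrt H *m B^T) ^+ 2 * dotcv e e <=
  dotcv (B^T *m e) (H *m (B^T *m e)).
Proof.
move=> [y _ <-]; have [Xsym XX] := psd_sqrtP mean_scaled_gram_psd.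
have HE v : dotcv (psd_sqrt H *m B^T *m v) (psd_sqrt H *m B^T *m v) =
    dotcv (B^T *m v) (H *m (B^T *m v)).
  by rewrite -mulmxA dotcv_mull Xsym mulmxA XX.
rewrite -HE; apply: sigma_min_le => v Xv0.
rewrite dotcv_mulr mean_scaled_gram_kernel ?dotcv0l//.
by rewrite -HE Xv0 dotcv0l.
Qed.

(** On the range of B, the quadratic form in [mean_scaled_gram_sigma_min] is at
    least sigma_min^2 |e|^2 and at most |e|^2; a nonzero e exists there. *)
Lemma sigma_min_le1 : B != 0 -> sigma_min (psd_sqrt H *m B^T) ^+ 2 <= 1.
Proof.
move=> B0; have [j Bj0] : exists j, B *m delta_mx j 0 != 0 :> 'cV_l.
  apply/not_existsP => h; case/negP : B0; apply/eqP/matrixP => i j.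
  by have /negP/negPn/eqP := h j; rewrite -colE => /colP/(_ i); rewrite !mxE.
have r : mxrange B (B *m delta_mx j 0) by exists (delta_mx j 0).
rewrite -dotcv_gt0 in Bj0.
rewrite -(ler_pM2r Bj0) mul1r.
exact: le_trans (mean_scaled_gram_sigma_min r) (mean_scaled_gram_le _).
Qed.

End scaled_gram_mean.
End mean_quadratic_form.

(** * Independent draws and freezing of the past *)

Section independence.
Context {R : realType} {d : measure_display} {U : measurableType d}.
Variable P : probability U R.
Context {I : choiceType}.
Variable F : I -> set_system U.

(** Finite intersections of events from the F j with j in J. They generate the
    same sigma-algebra as the union of these F j but, unlike it, are closed under
    intersection, as Dynkin's theorem requires. *)
Definition cylinder (J : set I) : set_system U :=
  [set B | exists (K : {fset I}) (E : I -> set U),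
    [/\ [set` K] `<=` J, forall i, i \in K -> F i (E i) &
        B = \bigcap_(i in [set` K]) E i]].

Hypothesis Fmeas : forall i A, F i A -> measurable A.
Hypothesis FT : forall i, F i setT.
Hypothesis FI : forall i, setI_closed (F i).

Lemma cylinder_setI J : setI_closed (cylinder J).
Proof.
move=> _ _ [K [E [KJ FE ->]]] [K' [E' [KJ' FE' ->]]].
(* Padding with the full set brings both intersections to the same index set. *)
pose ext (L : {fset I}) (D : I -> set U) i := if i \in L then D i else setT.
have extE L D : \bigcap_(i in [set` L]) D i = \bigcap_i ext L D i.
  rewrite [LHS]bigcap_mkcond; apply: eq_bigcapr => i _.
  by rewrite /ext mem_setE.
exists (K `|` K')%fset, (fun i => ext K E i `&` ext K' E' i); split.
- by move=> i /=; rewrite inE => /orP[/KJ|/KJ'].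
- move=> i _; apply: FI; rewrite /ext; case: ifPn => // iK.
    exact: FE.
  exact: FE'.
rewrite !extE -bigcapI; apply: eq_bigcapr => i _; rewrite /ext inE.
by case: (i \in K); case: (i \in K') => //=; rewrite setIT.
Qed.

Lemma cylinder_sub J i : J i -> F i `<=` cylinder J.
Proof.
move=> Ji B FB; exists [fset i]%fset, (fun=> B); split.
- by move=> j /=; rewrite inE => /eqP->.
- by move=> j; rewrite inE => /eqP->.
- by rewrite set_fset1 bigcap_set1.
Qed.

Lemma sigma_cylinder_measurable J : <<s cylinder J >> `<=` (measurable : set_system U).
Proof.
apply: smallest_sub; first exact: sigma_algebra_measurable.
move=> _ [K [E [_ FE ->]]]; apply: fin_bigcap_measurable; first exact: finite_fset.
by move=> i /FE /Fmeas.
Qed.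

(** Dynkin's pi-lambda theorem: on cylinders this is the independence hypothesis
    for the index set enlarged by i, and the events B satisfying it form a
    lambda-system. *)
Lemma independent_of_cylinders J i B C :
  mutually_independent P F -> ~ J i -> <<s cylinder J >> B -> F i C ->
  P (B `&` C) = (P B * P C)%E.
Proof.
move=> indep Ji sB FC; have mC := Fmeas FC.
apply: (@dynkin_induction _ (g_sigma_algebraType (cylinder J)) (cylinder J)
  (fun B => P (B `&` C) = (P B * P C)%E)) sB => //.
- exact: cylinder_setI.
- by rewrite setTI probability_setT mul1e.
- move=> _ [K [E [KJ FE ->]]].
  have iK : i \notin K by apply/negP => /KJ.
  pose E' j := if j == i then C else E j.
  have E'E j : j \in K -> E' j = E j.
    by rewrite /E'; case: eqVneq => // ->; rewrite (negbTE iK).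
  have E'i : E' i = C by rewrite /E' eqxx.
  have := indep (i |` K)%fset E'; rewrite big_fsetU1//= E'i.
  have -> : \bigcap_(j in [set` (i |` K)%fset]) E' j =
      (\bigcap_(j in [set` K]) E j) `&` C.
    rewrite set_fsetU set_fset1 bigcap_setU bigcap_set1 E'i setIC.
    by congr (_ `&` _); apply: eq_bigcapr => j /E'E.
  move=> ->; last first.
    move=> j; rewrite inE => /orP[|jK]; last by rewrite E'E//; exact: FE.
    by rewrite inE => /eqP->; rewrite E'i.
  rewrite muleC (indep K E)//; congr (_ * _)%E.
  by apply: eq_big_seq => j /E'E->.
- move=> S0 mS0 PS0; pose S : set U := S0.
  have mS : measurable S by exact: sigma_cylinder_measurable mS0.
  have PS : P (C `&` S) = (P S * P C)%E by rewrite setIC; exact: PS0.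
  change (P (~` S `&` C) = (P (~` S) * P C)%E).
  rewrite setIC -setDE measureD//; last by rewrite ltey_eq fin_num_measure.
  transitivity (P C - P S * P C)%E; first by congr (_ - _)%E; exact: PS.
  by rewrite probability_setC// muleBl ?mul1e// fin_num_measure.
- move=> G0 mG tG PG; pose G : (set U)^nat := G0.
  change (P (\bigcup_k G k `&` C) = (P (\bigcup_k G k) * P C)%E).
  have mG' k : measurable (G k) by apply: sigma_cylinder_measurable; exact: mG.
  rewrite setI_bigcupl !measure_bigcup//=; last 2 first.
  - by move=> k _; exact: measurableI.
  - exact: trivIset_setIr.
  rewrite muleC -(@fineK _ (P C)) ?fin_num_measure// -nneseriesZl//.
  by apply: eq_eseriesr => k _; rewrite fineK ?fin_num_measure// muleC; exact: PG.
Qed.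

End independence.

Section freezing.
Context {R : realType} {d : measure_display} {U : measurableType d}.
Variable P : probability U R.
Context {dV : measure_display} {V : measurableType dV}.
Context {dW : measure_display} {W : measurableType dW} (Q : probability W R).
Variables (X : {RV P >-> V}) (Y : {RV P >-> W}).
Hypothesis Y_law : forall D, measurable D -> distribution P Y D = Q D.
Hypothesis XY_indep : forall B D, measurable B -> measurable D ->
  P (X @^-1` B `&` Y @^-1` D) = (P (X @^-1` B) * P (Y @^-1` D))%E.

(** Independence says that the law of (X, Y) agrees with the product of the laws
    on rectangles, hence everywhere; then Tonelli's theorem applies. *)
Lemma integral_freeze (g : V * W -> \bar R) :
  measurable_fun setT g -> (forall vw, 0 <= g vw)%E ->
  (\int[P]_u g (X u, Y u) = \int[P]_u \int[Q]_w g (X u, w))%E.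
Proof.
move=> mg g0.
have mXY : measurable_fun setT (fun u => (X u, Y u)).
  by apply: measurable_fun_pair; exact: measurable_funPT.
pose XY : {mfun U >-> (V * W)%type} := mfun_Sub (mem_set mXY).
transitivity (\int[distribution P XY]_vw g vw)%E.
  by rewrite ge0_integral_distribution.
transitivity (\int[distribution P X \x Q]_vw g vw)%E.
  apply: eq_measure_integral => A mA _; apply/esym/product_measure_unique => //.
  move=> B D mB mD; transitivity (distribution P X B * distribution P Y D)%E.
    exact: XY_indep.
  by congr (_ * _)%E; exact: Y_law.
rewrite fubini_tonelli1// ge0_integral_distribution//.
  exact: measurable_fun_fubini_tonelli_F.
by move=> v; apply: integral_ge0.
Qed.

Lemma le_integral_freeze (g : V * W -> \bar R) (h : V -> \bar R) :
  measurable_fun setT g -> (forall vw, 0 <= g vw)%E -> measurable_fun setT h ->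
  (forall v, \int[Q]_w g (v, w) <= h v)%E ->
  (\int[P]_u g (X u, Y u) <= \int[P]_u h (X u))%E.
Proof.
move=> mg g0 mh gh; rewrite integral_freeze//; apply: ge0_le_integral => //.
- by move=> u _; apply: integral_ge0.
- apply: (@measurableT_comp _ _ _ _ _ _ (fun v => \int[Q]_w g (v, w))%E) => //.
  exact: measurable_fun_fubini_tonelli_F.
- exact: measurableT_comp.
Qed.

End freezing.

Section draws.
Context {R : realType} {d : measure_display} {U : measurableType d}.
Variable P : probability U R.
Context {d1 : measure_display} {U1 : measurableType d1}.
Context {d2 : measure_display} {U2 : measurableType d2}.
Variables (f : nat -> {RV P >-> U1}) (g : nat -> {RV P >-> U2}).

Lemma draws_sigma_measurable i A : draws_sigma f g i A -> measurable A.
Proof.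
by case: i => k [B mB <-]; rewrite setTI; exact: measurable_funPTI.
Qed.

Lemma draws_sigmaT i : draws_sigma f g i setT.
Proof. by case: i => k; exists setT; rewrite ?preimage_setT ?setTI. Qed.

Lemma draws_sigmaI i : setI_closed (draws_sigma f g i).
Proof.
case: i => k _ _ [A mA <-] [B mB <-]; exists (A `&` B);
  by rewrite ?setTI ?preimage_setI//; exact: measurableI.
Qed.

Definition past_sigma (J : set (nat + nat)) := cylinder (draws_sigma f g) J.

Lemma measurable_past J :
  measurable_fun setT (id : U -> g_sigma_algebraType (past_sigma J)).
Proof.
move=> _ B mB; rewrite setTI; apply: sigma_cylinder_measurable mB.
exact: draws_sigma_measurable.
Qed.

Lemma measurable_draw1 J k : J (inl k) ->
  measurable_fun setT (f k : g_sigma_algebraType (past_sigma J) -> U1).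
Proof.
move=> Jk _ B mB; rewrite setTI; apply: sub_sigma_algebra.
by apply: (cylinder_sub Jk); exists B; rewrite ?setTI.
Qed.

Lemma measurable_draw2 J k : J (inr k) ->
  measurable_fun setT (g k : g_sigma_algebraType (past_sigma J) -> U2).
Proof.
move=> Jk _ B mB; rewrite setTI; apply: sub_sigma_algebra.
by apply: (cylinder_sub Jk); exists B; rewrite ?setTI.
Qed.

Hypothesis indep : mutually_independent P (draws_sigma f g).

(** Here X is the identity of U seen as a random element of U with the
    sigma-algebra of the draws in J: a function measurable for the latter is one
    that depends on these draws only. *)
Lemma le_integral_draw J i {dW} {W : measurableType dW} (Q : probability W R)
    (Y : {RV P >-> W}) (G : g_sigma_algebraType (past_sigma J) * W -> \bar R)
    (h : g_sigma_algebraType (past_sigma J) -> \bar R) :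
  ~ J i -> g_sigma_algebra_preimage Y `<=` draws_sigma f g i ->
  (forall D, measurable D -> distribution P Y D = Q D) ->
  measurable_fun setT G -> (forall vw, 0 <= G vw)%E -> measurable_fun setT h ->
  (forall v, \int[Q]_w G (v, w) <= h v)%E ->
  (\int[P]_u G (u, Y u) <= \int[P]_u h u)%E.
Proof.
move=> Ji Yi Ylaw mG G0 mh Gh.
pose X : {mfun U >-> g_sigma_algebraType (past_sigma J)} :=
  mfun_Sub (mem_set (@measurable_past J)).
apply: (@le_integral_freeze _ _ _ P _ _ _ _ Q X Y) => // B D mB mD.
apply: (independent_of_cylinders draws_sigma_measurable draws_sigmaT draws_sigmaI
  indep Ji mB).
by apply: Yi; exists D; rewrite ?setTI.
Qed.

End draws.

(** * Measurability of the iterates *)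

Section measurable_matrices.
Context {R : realType} {d : measure_display} {V : measurableType d}.

(** For nonnegative values the inverse, including 0^-1 = 0, is a real power. *)
Lemma measurable_funV (f : V -> R) : measurable_fun setT f -> (forall v, 0 <= f v) ->
  measurable_fun setT (fun v => (f v)^-1).
Proof.
move=> mf f0; under eq_fun do rewrite -powR_inv1//.
by apply: (@measurableT_comp _ _ _ _ _ _ (@powR R ^~ (-1))) => //; exact: measurable_powR.
Qed.

Definition mx_measurable m n (X : V -> 'M[R]_(m, n)) :=
  forall i j, measurable_fun setT (fun v => X v i j).

Lemma mx_measurable_cst m n (M : 'M[R]_(m, n)) : mx_measurable (fun=> M).
Proof. by move=> i j; exact: measurable_cst. Qed.

Lemma mx_measurableZ m n (a : V -> R) (X : V -> 'M[R]_(m, n)) :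
  measurable_fun setT a -> mx_measurable X -> mx_measurable (fun v => a v *: X v).
Proof.
by move=> ma mX i j; under eq_fun do rewrite mxE; exact: measurable_funM.
Qed.

Lemma mx_measurableB m n (X Y : V -> 'M[R]_(m, n)) :
  mx_measurable X -> mx_measurable Y -> mx_measurable (fun v => X v - Y v).
Proof.
by move=> mX mY i j; under eq_fun do rewrite !mxE; exact: measurable_funB.
Qed.

Lemma mx_measurableM m n l (X : V -> 'M[R]_(m, n)) (Y : V -> 'M[R]_(n, l)) :
  mx_measurable X -> mx_measurable Y -> mx_measurable (fun v => X v *m Y v).
Proof.
move=> mX mY i j; under eq_fun do rewrite mxE.
by apply: measurable_sum => k; exact: measurable_funM.
Qed.

Lemma measurable_dotcv n (X Y : V -> 'cV[R]_n) :
  mx_measurable X -> mx_measurable Y -> measurable_fun setT (fun v => dotcv (X v) (Y v)).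
Proof.
move=> mX mY; under eq_fun do rewrite dotcvE.
by apply: measurable_sum => k; exact: measurable_funM.
Qed.

Lemma measurable_l2norm_sq n (X : V -> 'cV[R]_n) : mx_measurable X ->
  measurable_fun setT (fun v => (l2norm (X v) ^+ 2)%:E).
Proof.
move=> mX; apply/measurable_EFinP; under eq_fun do rewrite l2norm_sq.
exact: measurable_dotcv.
Qed.

End measurable_matrices.

Lemma mx_measurable_comp (R : realType) d d' (V : measurableType d) (W : measurableType d')
    m n (X : W -> 'M[R]_(m, n)) (f : V -> W) :
  mx_measurable X -> measurable_fun setT f -> mx_measurable (X \o f).
Proof. by move=> mX mf i j; exact: (measurableT_comp (mX i j)). Qed.

Section step_through_gram.
Context {R : realType}.

(** Both updates depend on the random matrix only through its Gram matrix G. This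
    matters for measurability: the number of columns of a draw is random, and
    only the entries of its Gram matrix are known to be measurable functions.
    The case distinction in the step-size disappears since 0 / 0 = 0. *)
Definition gram_step l p (B : 'M[R]_(l, p)) (beta : R) (G : 'M[R]_p)
    (r : 'cV[R]_p) (x : 'cV[R]_l) : 'cV[R]_l :=
  let u := B *m (G *m r) in
  x - (beta * (dotcv r (G *m r) * (dotcv u u)^-1)) *: u.

Lemma z_step_gram m n (A : 'M[R]_(m, n)) eta q (T : 'M[R]_(n, q)) z :
  z_step A eta T z = gram_step A (2 - eta) (T *m T^T) (A^T *m z) z.
Proof.
rewrite /z_step /gram_step dotcv_gram !l2norm_sq !mulmxA.
congr (_ - _ *: _); case: ifPn => // /negPn/eqP ->.
by rewrite dotcv0l mul0r mulr0.
Qed.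

Lemma x_step_gram m n (A : 'M[R]_(m, n)) b zeta p (S : 'M[R]_(m, p)) z x :
  x_step A b zeta S z x =
  gram_step A^T (2 - zeta) (S *m S^T) (A *m x - (b - z)) x.
Proof.
rewrite /x_step /gram_step dotcv_gram !l2norm_sq !mulmxA.
congr (_ - _ *: _); case: ifPn => // /negPn/eqP ->.
by rewrite dotcv0l mul0r mulr0.
Qed.

Lemma mx_measurable_gram_step d (V : measurableType d) l p (B : 'M[R]_(l, p))
    beta (G : V -> 'M[R]_p) r x :
  mx_measurable G -> mx_measurable r -> mx_measurable x ->
  mx_measurable (fun v => gram_step B beta (G v) (r v) (x v)).
Proof.
move=> mG mr mx; rewrite /gram_step.
have mGr : mx_measurable (fun v => G v *m r v) by exact: mx_measurableM.
have mu : mx_measurable (fun v => B *m (G v *m r v)).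
  by apply: mx_measurableM => //; exact: mx_measurable_cst.
apply: mx_measurableB => //; apply: mx_measurableZ => //.
apply: measurable_funM => //; apply: measurable_funM; first exact: measurable_dotcv.
apply: measurable_funV; first exact: measurable_dotcv.
by move=> v; exact: dotcv_ge0.
Qed.

End step_through_gram.

Section iterates.
Context {R : realType} {m n : nat} (A : 'M[R]_(m, n)) (b : 'cV[R]_m) (eta zeta : R).

Lemma mx_integrable_measurable d (W : measurableType d) (P : probability W R)
    k l (X : W -> 'M[R]_(k, l)) : mx_integrable P X -> mx_measurable X.
Proof. by move=> iX i j; have /integrableP[/measurable_EFinP] := iX i j. Qed.

Lemma z_step_range q (T : 'M[R]_(n, q)) z zs :
  mxrange A (z - zs) -> mxrange A (z_step A eta T z - zs).
Proof.
move=> rz; rewrite z_step_gram /gram_step addrAC.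
apply: mxrangeB => //; apply: mxrangeZ.
by exists (T *m T^T *m (A^T *m z)).
Qed.

Lemma x_step_range p (S : 'M[R]_(m, p)) z x xs :
  mxrange A^T (x - xs) -> mxrange A^T (x_step A b zeta S z x - xs).
Proof.
move=> rx; rewrite x_step_gram /gram_step addrAC.
apply: mxrangeB => //; apply: mxrangeZ.
by exists (S *m S^T *m (A *m x - (b - z))).
Qed.

Context {dV : measure_display} {V : measurableType dV}.
Context {dbar : measure_display} {Omegabar : measurableType dbar}.
Context {d : measure_display} {Omega : measurableType d}.
Variables (p : Omega -> nat) (S : forall w, 'M[R]_(m, p w)).
Variables (q : Omegabar -> nat) (T : forall w, 'M[R]_(n, q w)).
Variables (tau : nat -> V -> Omegabar) (sig : nat -> V -> Omega).
Variables (z0 : 'cV[R]_m) (x0 : 'cV[R]_n).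
Hypothesis (mT : mx_measurable (gram T)) (mS : mx_measurable (gram S)).

Let z k v := z_iter A eta (fun j => T (tau j v)) z0 k.
Let x k v := x_iter A b eta zeta (fun j => T (tau j v)) (fun j => S (sig j v)) z0 x0 k.

Lemma mx_measurable_z_iter k :
  (forall j, (j < k)%N -> measurable_fun setT (tau j)) -> mx_measurable (z k).
Proof.
elim: k => [_|k IH mtau]; first exact: mx_measurable_cst.
have mz : mx_measurable (z k) by apply: IH => j jk; apply: mtau; exact: ltnW.
rewrite /z/=; under eq_fun do rewrite z_step_gram.
apply: mx_measurable_gram_step => //.
  by apply: (mx_measurable_comp mT); exact: mtau.
by apply: mx_measurableM => //; exact: mx_measurable_cst.
Qed.

Lemma mx_measurable_x_iter k :
  (forall j, (j < k)%N -> measurable_fun setT (tau j)) ->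
  (forall j, (j < k)%N -> measurable_fun setT (sig j)) -> mx_measurable (x k).
Proof.
elim: k => [_ _|k IH mtau msig]; first exact: mx_measurable_cst.
have mx : mx_measurable (x k).
  by apply: IH => j jk; [apply: mtau|apply: msig]; exact: ltnW.
have mz := mx_measurable_z_iter mtau.
rewrite /x/=; under eq_fun do rewrite x_step_gram.
apply: mx_measurable_gram_step => //.
  by apply: (mx_measurable_comp mS); exact: msig.
apply: mx_measurableB.
  by apply: mx_measurableM => //; exact: mx_measurable_cst.
by apply: mx_measurableB => //; exact: mx_measurable_cst.
Qed.

End iterates.

(** * One step in mean *)

Section mean_step.
Context {R : realType} {m n : nat} (A : 'M[R]_(m, n)).

Lemma le_mean_affine_quad d (W : measurableType d) (P : probability W R) k
    (X : W -> 'M[R]_k) (f : W -> R) a c1 v1 c2 v2 :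
  let H := mx_expectation P X in
  mx_integrable P X -> measurable_fun setT f -> (forall w, 0 <= f w) ->
  (forall w, f w <= a + c1 * dotcv v1 (X w *m v1) + c2 * dotcv v2 (X w *m v2)) ->
  (\int[P]_w (f w)%:E <=
   (a + c1 * dotcv v1 (H *m v1) + c2 * dotcv v2 (H *m v2))%:E)%E.
Proof.
move=> H iX mf f0 fle.
have i1 := integrableZl measurableT c1 (quad_integrable v1 iX).
have i2 := integrableZl measurableT c2 (quad_integrable v2 iX).
have ia : P.-integrable setT (fun=> a%:E).
  exact: finite_measure_integrable_cst.
have i1' := integrableD measurableT ia i1.
have i3 := integrableD measurableT i1' i2.
rewrite !EFinD !EFinM -!quad_integral// -!integralZl ?quad_integrable//.
have -> : (a%:E = \int[P]_w a%:E)%E by rewrite integral_cst//= probability_setT mule1.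
rewrite -!integralD//; apply: ge0_le_integral => //.
- by move=> w _; rewrite lee_fin.
- exact/measurable_EFinP.
- by have /integrableP[] := i3.
- by move=> w _; rewrite -!EFinM -!EFinD lee_fin.
Qed.

Lemma z_step_mean d (W : measurableType d) (P : probability W R)
    (q : W -> nat) (T : forall w, 'M[R]_(n, q w)) eta z zs :
  let H := mx_expectation P (scaled_gram A T) in
  mx_integrable P (gram T) -> posdef (mx_expectation P (gram T)) ->
  mx_integrable P (scaled_gram A T) ->
  0 < eta < 2 -> A^T *m zs = 0 -> mxrange A (z - zs) ->
  (\int[P]_w (l2norm (z_step A eta (T w) z - zs) ^+ 2)%:E <=
   (rho_z A eta H * l2norm (z - zs) ^+ 2)%:E)%E.
Proof.
move=> H iT Tpd iG eta02 Azs rz.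
have mT := mx_integrable_measurable iT.
pose v := A^T *m (z - zs).
apply: le_trans
  (le_mean_affine_quad (a := l2norm (z - zs) ^+ 2) (c1 := - (eta * (2 - eta)))
    (v1 := v) (c2 := 0) (v2 := 0) iG _ _ _) _.
- apply/measurable_EFinP/measurable_l2norm_sq.
  under eq_fun do rewrite z_step_gram.
  apply: mx_measurableB; last exact: mx_measurable_cst.
  by apply: mx_measurable_gram_step => //; exact: mx_measurable_cst.
- by move=> w; rewrite sqr_ge0.
- move=> w; rewrite mul0r addr0 mulNr scaled_gram_quad.
  exact: z_step_le.
rewrite lee_fin mul0r addr0 /rho_z mulrBl mul1r lerD2l mulNr lerN2 -[leLHS]mulrA.
rewrite ler_wpM2l//; first by case/andP: eta02 => ? ?; apply: mulr_ge0; lra.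
by rewrite l2norm_sq; exact: mean_scaled_gram_sigma_min.
Qed.

Lemma x_step_mean d (W : measurableType d) (P : probability W R)
    (p : W -> nat) (S : forall w, 'M[R]_(m, p w)) (b : 'cV[R]_m)
    zeta eps L z zs x xs :
  let H := mx_expectation P (scaled_gram A^T S) in
  mx_integrable P (gram S) -> posdef (mx_expectation P (gram S)) ->
  mx_integrable P (scaled_gram A^T S) ->
  admissible zeta eps ->
  A *m xs = b - zs -> mxrange A (z - zs) -> mxrange A^T (x - xs) -> 0 < L ->
  (forall w, A^T *m S w != 0 -> L <= lambda_min
    (spectral_norm (A^T *m S w) ^- 2 *: (A^T *m S w *m (S w)^T *m A))) ->
  (\int[P]_w (l2norm (x_step A b zeta (S w) z x - xs) ^+ 2)%:E <=
   (rho_x A zeta eps H * l2norm (x - xs) ^+ 2 +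
    d_const zeta eps * lambda_max H / L * l2norm (z - zs) ^+ 2)%:E)%E.
Proof.
move=> H iS Spd iG zeps Axs rz rx L0 Lle.
have mS := mx_integrable_measurable iS.
have [zeta02 eps0 eps1] := admissible_bounds zeps.
have /andP[c0 _] := c_const_ge0 zeps.
have d0 := d_const_ge0 zeps.
apply: le_trans
  (le_mean_affine_quad (a := l2norm (x - xs) ^+ 2) (c1 := - c_const zeta eps)
    (v1 := A *m (x - xs)) (c2 := d_const zeta eps / L) (v2 := z - zs) iG _ _ _) _.
- apply/measurable_EFinP/measurable_l2norm_sq.
  under eq_fun do rewrite x_step_gram.
  apply: mx_measurableB; last exact: mx_measurable_cst.
  by apply: mx_measurable_gram_step => //; exact: mx_measurable_cst.
- by move=> w; rewrite sqr_ge0.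
- move=> w; rewrite mulNr !scaled_gram_quad.
  by apply: x_step_le => //; exact: Lle.
rewrite lee_fin -/H; apply: lerD.
  rewrite /rho_x mulrBl mul1r lerD2l mulNr lerN2 -[leLHS]mulrA ler_wpM2l//.
  have := mean_scaled_gram_sigma_min iG iS Spd rx; rewrite trmxK l2norm_sq.
  exact.
rewrite (mulrAC _ (lambda_max H)) -[leRHS]mulrA l2norm_sq ler_wpM2l//.
  by rewrite divr_ge0// ltW.
by apply: lambda_max_rayleigh; have [] := mean_scaled_gram_psd iG.
Qed.

End mean_step.

(** * Signs of the constants *)

Section constants.
Context {R : realType} {m n : nat} (A : 'M[R]_(m, n)).

(** The infimum is over a finite set of positive numbers. That set is nonempty: if
    A^T S vanished for every S, so would A^T E[S S^T] A, which forces A = 0. *)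
Lemma Lambda_minP d (W : measurableType d) (P : probability W R)
    (p : W -> nat) (S : forall w, 'M[R]_(m, p w)) :
  A != 0 -> finite_set [set: W] ->
  mx_integrable P (gram S) -> posdef (mx_expectation P (gram S)) ->
  0 < Lambda_min A S /\ forall w, A^T *m S w != 0 -> Lambda_min A S <= lambda_min
    (spectral_norm (A^T *m S w) ^- 2 *: (A^T *m S w *m (S w)^T *m A)).
Proof.
move=> A0 finW iS Spd.
have gramE w : A^T *m S w *m (S w)^T *m A = ((S w)^T *m A)^T *m ((S w)^T *m A).
  by rewrite trmx_mul trmxK !mulmxA.
have pos w : A^T *m S w != 0 -> 0 < lambda_min
    (spectral_norm (A^T *m S w) ^- 2 *: (A^T *m S w *m (S w)^T *m A)).
  move=> AS0; rewrite gramE scaled_lambda_min_gt0//.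
    by rewrite invr_gt0 spectral_norm_sq_gt0.
  by rewrite -(inj_eq trmx_inj) trmx_mul trmxK trmx0.
split; last first.
  move=> w AS0; apply: ge_inf; last by exists w.
  by exists 0 => _ [w' /= AS'0 <-]; rewrite ltW// pos.
apply: inf_finite_gt0; last by move=> _ [w AS0 <-]; exact: pos.
- apply: contrapT => /set0P/negP/negPn/eqP AS.
  have AS0 w : A^T *m S w = 0.
    apply: contrapT => /eqP AS0.
    suff : set0 (lambda_min (spectral_norm (A^T *m S w) ^- 2 *:
      (A^T *m S w *m (S w)^T *m A))) by [].
    by rewrite -AS; exists w.
  case/negP: A0; apply/eqP/matrixP => i j; rewrite mxE.
  suff : A *m delta_mx j 0 = 0 :> 'cV_m by rewrite -colE => /colP/(_ i); rewrite !mxE.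
  apply: contrapT => /eqP /Spd.2.
  rewrite -lte_fin -quad_integral// (eq_integral (cst 0%E)) ?integral0 ?ltxx//.
  move=> w _; rewrite dotcv_gram mulmxA -[A]trmxK -trmx_mul AS0 trmx0 mul0mx.
  by rewrite dotcv0l.
- exact/finite_image/(sub_finite_set (@subsetT _ _)).
Qed.

Lemma lambda_max_ge0 k (M : 'M[R]_k) : possemidef M -> 0 <= lambda_max M.
Proof.
move=> /psd_sqrtP[Xsym XX]; apply: sup_nonneg => a.
by rewrite /= -XX -{1}Xsym; exact: gram_eigenvalue_ge0.
Qed.

Lemma rho_x_ge0 d (W : measurableType d) (P : probability W R)
    (p : W -> nat) (S : forall w, 'M[R]_(m, p w)) zeta eps :
  A != 0 -> mx_integrable P (gram S) -> posdef (mx_expectation P (gram S)) ->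
  mx_integrable P (scaled_gram A^T S) ->
  admissible zeta eps ->
  0 <= rho_x A zeta eps (mx_expectation P (scaled_gram A^T S)).
Proof.
move=> A0 iS Spd iG /c_const_ge0/andP[c0 c1].
have A0' : A^T != 0 by rewrite -(inj_eq trmx_inj) trmxK trmx0.
have := sigma_min_le1 iG iS Spd A0'; rewrite trmxK => s1.
by rewrite /rho_x subr_ge0 mulr_ile1// exprn_ge0// sigma_min_ge0.
Qed.

End constants.

(** * Convolution of two geometric sequences *)

Section geometric_convolution.
Context {R : realType}.

(** The solution of s (k+1) = x s k + z^(k+1) with s 0 = 0. *)
Definition geom_conv (x z : R) k := z * \sum_(i < k) x ^+ (k.-1 - i) * z ^+ i.

Lemma geom_convS x z k :
  geom_conv x z k.+1 = x * geom_conv x z k + z ^+ k.+1.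
Proof.
rewrite /geom_conv big_ord_recr/= subnn expr0 mul1r mulrDr -exprS; congr (_ + _).
rewrite [RHS]mulrCA; congr (_ * _); rewrite mulr_sumr; apply: eq_bigr => i _.
by rewrite mulrA -exprS -subSn; case: k i => [[]//|k i]; rewrite ?leq_ord.
Qed.

Lemma geom_conv_ge0 x z k : 0 <= x -> 0 <= z -> 0 <= geom_conv x z k.
Proof.
move=> x0 z0; rewrite mulr_ge0// sumr_ge0// => i _.
by rewrite mulr_ge0// exprn_ge0.
Qed.

(** If the maximum is 1 / k, each of the k summands is estimated by the k-th power
    of the larger ratio. Otherwise the sum is evaluated: multiplied by
    |1 - x / z| it becomes |z^k - x^k|. *)
Lemma geom_conv_le x z k : 0 <= x -> 0 < z -> (0 < k)%N ->
  geom_conv x z k * Num.max `|1 - x / z| k%:R^-1 <= Num.max z x ^+ k.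
Proof.
move=> x0 z0 k0; set r := Num.max z x.
have zr : z <= r by rewrite le_max lexx.
have xr : x <= r by rewrite le_max lexx orbT.
have r0 : 0 <= r by rewrite (le_trans x0).
rewrite maxEle; case: ifP => _; last first.
  have -> : geom_conv x z k * `|1 - x / z| = `|z ^+ k - x ^+ k|.
    rewrite -[geom_conv _ _ _]ger0_norm; last by rewrite geom_conv_ge0// ltW.
    rewrite -normrM -[LHS]normrN -[RHS]normrN opprB subrXX; congr `|_|.
    rewrite /geom_conv; set s := \sum_(i < k) _.
    by field; rewrite gt_eqF.
  have zk : 0 <= z ^+ k <= r ^+ k by rewrite exprn_ge0 ?lerXn2r ?nnegrE// ltW.
  have xk : 0 <= x ^+ k <= r ^+ k by rewrite exprn_ge0 ?lerXn2r ?nnegrE.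
  rewrite ler_norml; lra.
rewrite ler_pdivrMr ?ltr0n// /geom_conv mulr_sumr.
apply: (@le_trans _ _ (\sum_(i < k) r ^+ k)); last by rewrite sumr_const card_ord mulr_natr.
apply: ler_sum => i _; rewrite mulrCA -exprS.
have -> : r ^+ k = r ^+ (k.-1 - i) * r ^+ i.+1.
  by rewrite -exprD addnS subnK ?prednK// -ltnS prednK.
rewrite ler_pM ?exprn_ge0 ?(ltW z0)//.
  by rewrite lerXn2r ?nnegrE.
by rewrite lerXn2r ?nnegrE ?(ltW z0).
Qed.

End geometric_convolution.

(** * The recursions for the mean squared errors *)

Section recursions.
Context {R : realType} {m n : nat} (A : 'M[R]_(m, n)) (b : 'cV[R]_m).
Context {d : measure_display} {Omega : measurableType d} (P : probability Omega R).
Variables (p : Omega -> nat) (S : forall w, 'M[R]_(m, p w)).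
Context {dbar : measure_display} {Omegabar : measurableType dbar}.
Variable Pbar : probability Omegabar R.
Variables (q : Omegabar -> nat) (T : forall w, 'M[R]_(n, q w)).
Context {dU : measure_display} {U : measurableType dU} (Pr : probability U R).
Variables (tau : nat -> {RV Pr >-> Omegabar}) (sig : nat -> {RV Pr >-> Omega}).
Variables (eta zeta eps L : R) (z0 : 'cV[R]_m) (x0 : 'cV[R]_n).
Variables (zs : 'cV[R]_m) (xs : 'cV[R]_n).

Let z k u := z_iter A eta (fun j => T (tau j u)) z0 k.
Let x k u := x_iter A b eta zeta (fun j => T (tau j u)) (fun j => S (sig j u)) z0 x0 k.
Let H := mx_expectation P (scaled_gram A^T S).
Let Hbar := mx_expectation Pbar (scaled_gram A T).

Hypothesis iT : mx_integrable Pbar (gram T).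
Hypothesis Tpd : posdef (mx_expectation Pbar (gram T)).
Hypothesis iS : mx_integrable P (gram S).
Hypothesis Spd : posdef (mx_expectation P (gram S)).
Hypothesis iGT : mx_integrable Pbar (scaled_gram A T).
Hypothesis iGS : mx_integrable P (scaled_gram A^T S).
Hypothesis lawT : forall k B, measurable B -> distribution Pr (tau k) B = Pbar B.
Hypothesis lawS : forall k B, measurable B -> distribution Pr (sig k) B = P B.
Hypothesis indep : mutually_independent Pr (draws_sigma tau sig).
Hypothesis eta02 : 0 < eta < 2.
Hypothesis Azs : A^T *m zs = 0.
Hypothesis rz0 : mxrange A (z0 - zs).
Hypothesis rx0 : mxrange A^T (x0 - xs).

(** In each round T_k is drawn before S_k: (k, k) describes the moment before the
    draw of T_k and (k+1, k) the one before the draw of S_k. *)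
Let drawn k l : set (nat + nat) :=
  [set i | match i with inl j => (j < k)%N | inr j => (j < l)%N end].

Let past k l := g_sigma_algebraType (past_sigma tau sig (drawn k l)).

Let mT := mx_integrable_measurable iT.
Let mS := mx_integrable_measurable iS.

Let range_z k u : mxrange A (z k u - zs).
Proof. by elim: k => [|k IH] //; exact: z_step_range. Qed.

Let range_x k u : mxrange A^T (x k u - xs).
Proof. by elim: k => [|k IH] //; exact: x_step_range. Qed.

Let mz j k l : (j <= k)%N -> mx_measurable (z j : past k l -> _).
Proof.
move=> jk; apply: mx_measurable_z_iter => // i ij.
by apply: measurable_draw1 => /=; exact: leq_trans jk.
Qed.

Let mx j k l : (j <= k)%N -> (j <= l)%N -> mx_measurable (x j : past k l -> _).
Proof.
move=> jk jl; apply: mx_measurable_x_iter => // i ij.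
  by apply: measurable_draw1 => /=; exact: leq_trans jk.
by apply: measurable_draw2 => /=; exact: leq_trans jl.
Qed.

Let mEz k : measurable_fun [set: U] (fun u => (l2norm (z k u - zs) ^+ 2)%:E).
Proof.
apply: measurable_l2norm_sq; apply: mx_measurableB; last exact: mx_measurable_cst.
by apply: mx_measurable_z_iter => // j _; exact: measurable_funPT.
Qed.

Let mEx k : measurable_fun [set: U] (fun u => (l2norm (x k u - xs) ^+ 2)%:E).
Proof.
apply: measurable_l2norm_sq; apply: mx_measurableB; last exact: mx_measurable_cst.
by apply: mx_measurable_x_iter => // j _; exact: measurable_funPT.
Qed.

Lemma mean_z_le k : 0 <= rho_z A eta Hbar ->
  (\int[Pr]_u (l2norm (z k u - zs) ^+ 2)%:E <=
   (rho_z A eta Hbar ^+ k * l2norm (z0 - zs) ^+ 2)%:E)%E.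
Proof.
move=> rhoz0; elim: k => [|k IH].
  by rewrite /z/= integral_cst//= probability_setT mule1 expr0 mul1r.
apply: (@le_trans _ _
  (\int[Pr]_u (rho_z A eta Hbar * l2norm (z k u - zs) ^+ 2)%:E)%E).
  apply: (@le_integral_draw _ _ _ Pr _ _ _ _ tau sig indep (drawn k k) (inl k)
    _ _ Pbar (tau k)
    (fun vw => (l2norm (z_step A eta (T vw.2) (z k vw.1) - zs) ^+ 2)%:E)
    (fun u => (rho_z A eta Hbar * l2norm (z k u - zs) ^+ 2)%:E)) => //=.
  - by rewrite ltnn.
  - exact: lawT.
  - apply: measurable_l2norm_sq; apply: mx_measurableB; last exact: mx_measurable_cst.
    under eq_fun do rewrite z_step_gram.
    have mz1 : mx_measurable (fun vw : past k k * Omegabar => z k vw.1).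
      by apply: mx_measurable_comp measurable_fst; exact: mz.
    apply: mx_measurable_gram_step => //.
      by apply: (mx_measurable_comp mT); exact: measurable_snd.
    by apply: mx_measurableM => //; exact: mx_measurable_cst.
  - by move=> vw; rewrite lee_fin sqr_ge0.
  - apply/measurable_EFinP; apply: measurable_funM => //.
    apply/measurable_EFinP; apply: measurable_l2norm_sq; apply: mx_measurableB.
      exact: mz.
    exact: mx_measurable_cst.
  - by move=> u; exact: z_step_mean.
under eq_integral do rewrite EFinM.
rewrite ge0_integralZl_EFin//; last by move=> u _; rewrite lee_fin sqr_ge0.
by rewrite exprS -mulrA EFinM lee_wpmul2l// lee_fin.
Qed.

Hypothesis zeps : admissible zeta eps.
Hypothesis Axs : A *m xs = b - zs.
Hypothesis L0 : 0 < L.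
Hypothesis Lle : forall w, A^T *m S w != 0 -> L <= lambda_min
    (spectral_norm (A^T *m S w) ^- 2 *: (A^T *m S w *m (S w)^T *m A)).

Let gam := d_const zeta eps * lambda_max H / L.

Lemma mean_x_le k : 0 <= rho_z A eta Hbar -> 0 <= rho_x A zeta eps H -> 0 <= gam ->
  (\int[Pr]_u (l2norm (x k u - xs) ^+ 2)%:E <=
   (rho_x A zeta eps H ^+ k * l2norm (x0 - xs) ^+ 2 +
    gam * l2norm (z0 - zs) ^+ 2 *
      geom_conv (rho_x A zeta eps H) (rho_z A eta Hbar) k)%:E)%E.
Proof.
move=> rhoz0 rhox0 gam0; elim: k => [|k IH].
  rewrite /x/= integral_cst//= probability_setT mule1 expr0 mul1r.
  by rewrite lee_fin lerDl mulr_ge0 ?geom_conv_ge0// mulr_ge0// sqr_ge0.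
apply: (@le_trans _ _ (\int[Pr]_u (rho_x A zeta eps H * l2norm (x k u - xs) ^+ 2 +
    gam * l2norm (z k.+1 u - zs) ^+ 2)%:E)%E).
  apply: (@le_integral_draw _ _ _ Pr _ _ _ _ tau sig indep (drawn k.+1 k) (inr k)
    _ _ P (sig k)
    (fun vw => (l2norm (x_step A b zeta (S vw.2) (z k.+1 vw.1) (x k vw.1) - xs) ^+ 2)%:E)
    (fun u => (rho_x A zeta eps H * l2norm (x k u - xs) ^+ 2 +
      gam * l2norm (z k.+1 u - zs) ^+ 2)%:E)) => //.
  - by rewrite /= ltnn.
  - exact: lawS.
  - apply: measurable_l2norm_sq; apply: mx_measurableB; last exact: mx_measurable_cst.
    under eq_fun do rewrite x_step_gram.
    have mz1 : mx_measurable (fun vw : past k.+1 k * Omega => z k.+1 vw.1).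
      by apply: mx_measurable_comp measurable_fst; exact: mz.
    have mx1 : mx_measurable (fun vw : past k.+1 k * Omega => x k vw.1).
      by apply: mx_measurable_comp measurable_fst; exact: mx.
    apply: mx_measurable_gram_step => //.
      by apply: (mx_measurable_comp mS); exact: measurable_snd.
    apply: mx_measurableB.
      by apply: mx_measurableM => //; exact: mx_measurable_cst.
    by apply: mx_measurableB => //; exact: mx_measurable_cst.
  - by move=> vw; rewrite lee_fin sqr_ge0.
  - apply/measurable_EFinP; apply: measurable_funD; apply: measurable_funM => //;
      apply/measurable_EFinP; apply: measurable_l2norm_sq; apply: mx_measurableB;
      try exact: mx_measurable_cst.
    + exact: mx.
    + exact: mz.
  - by move=> u; exact: (x_step_mean iS Spd iGS zeps Axs (range_z k.+1 u) (range_x k u) L0 Lle).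
under eq_integral do rewrite EFinD (EFinM (rho_x A zeta eps H)) (EFinM gam).
rewrite ge0_integralD//; last 4 first.
- by move=> u _; rewrite -EFinM lee_fin mulr_ge0// sqr_ge0.
- by apply: measurable_funeM; exact: mEx.
- by move=> u _; rewrite -EFinM lee_fin mulr_ge0// sqr_ge0.
- by apply: measurable_funeM; exact: mEz.
rewrite !ge0_integralZl_EFin//; try by move=> u _; rewrite lee_fin sqr_ge0.
apply: (@le_trans _ _ ((rho_x A zeta eps H)%:E * (rho_x A zeta eps H ^+ k *
    l2norm (x0 - xs) ^+ 2 + gam * l2norm (z0 - zs) ^+ 2 *
      geom_conv (rho_x A zeta eps H) (rho_z A eta Hbar) k)%:E +
  gam%:E * (rho_z A eta Hbar ^+ k.+1 * l2norm (z0 - zs) ^+ 2)%:E)%E).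
  by apply: leeD; apply: lee_wpmul2l; rewrite ?lee_fin//; exact: mean_z_le.
by rewrite -!EFinM -EFinD lee_fin geom_convS (exprS (rho_x A zeta eps H)) le_eqVlt; apply/orP; left; apply/eqP; ring.
Qed.

End recursions.

Theorem theorem3p4 (R : realType) (m n : nat)
  (A : 'M[R]_(m, n)) (b : 'cV[R]_m)
  (* the probability space (Omega, F, P) of matrices with m rows *)
  (d : measure_display) (Omega : measurableType d) (P : probability Omega R)
  (p : Omega -> nat) (S : forall w, 'M[R]_(m, p w))
  (* the probability space (Omegabar, Fbar, Pbar) of matrices with n rows *)
  (dbar : measure_display) (Omegabar : measurableType dbar)
  (Pbar : probability Omegabar R)
  (q : Omegabar -> nat) (T : forall w, 'M[R]_(n, q w))
  (* the space carrying the draws, with T_k = T (tau k u), S_k = S (sig k u) *)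
  (dU : measure_display) (U : measurableType dU) (Pr : probability U R)
  (tau : nat -> {RV Pr >-> Omegabar}) (sig : nat -> {RV Pr >-> Omega})
  (eta zeta eps : R) (z0 : 'cV[R]_m) (x0 : 'cV[R]_n) :
  let H := mx_expectation P (scaled_gram A^T S) in
  let Hbar := mx_expectation Pbar (scaled_gram A T) in
  let rhoz := rho_z A eta Hbar in
  let rhox := rho_x A zeta eps H in
  let rho := Num.max rhoz rhox in
  let x k u := x_iter A b eta zeta (fun j => T (tau j u))
                 (fun j => S (sig j u)) z0 x0 k in
  A != 0 ->
  mx_integrable Pbar (gram T) ->
  posdef (mx_expectation Pbar (gram T)) ->
  mx_integrable P (gram S) ->
  posdef (mx_expectation P (gram S)) ->
  mx_integrable Pbar (scaled_gram A T) ->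
  mx_integrable P (scaled_gram A^T S) ->
  finite_set [set: Omega] ->
  (forall k B, measurable B -> distribution Pr (tau k) B = Pbar B) ->
  (forall k B, measurable B -> distribution Pr (sig k) B = P B) ->
  mutually_independent Pr (draws_sigma tau sig) ->
  0 < eta < 2 ->
  mxrange A (z0 - b) ->
  mxrange A^T x0 ->
  (0 < zeta <= 1 / 2) && (0 < eps < zeta / (1 - zeta)) \/
  (1 / 2 < zeta < 2) && (0 < eps <= 1) ->
  0 < rhoz ->
  forall k : nat, (1 <= k)%N ->
  ('E_Pr [fun u => (l2norm (x k u - mp_inverse A *m b) ^+ 2)%R]
   <= (rho ^+ k *
       (l2norm (x0 - mp_inverse A *m b) ^+ 2 +
        d_const zeta eps * lambda_max H /
          (Lambda_min A S * Num.max `|1 - rhox / rhoz| (k%:R^-1)) *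
        l2norm (z0 - orthproj (orthc (mxrange A)) b) ^+ 2))%:E)%E.
Proof.
move=> H Hbar rhoz rhox rho x A0 iT Tpd iS Spd iGT iGS finO lawT lawS indep eta02.
move=> rz0 rx0 zeps rhoz0 k k0; rewrite unlock.
set xs := mp_inverse A *m b; set zs := orthproj _ b.
have zsE : zs = b - A *m xs by rewrite /zs orthproj_range_orthc mulmxA.
have Azs : A^T *m zs = 0 by rewrite zsE mulmxA mp_inverse_normal_equation.
have Axs : A *m xs = b - zs by rewrite zsE opprB addrC subrK.
have rz : mxrange A (z0 - zs).
  rewrite zsE opprB addrA [_ + A *m xs]addrC -addrA; apply: mxrangeD => //.
  by exists xs.
have rx : mxrange A^T (x0 - xs) by apply: mxrangeB => //; exact: mp_inverse_range.
have [L0 Lle] := Lambda_minP A0 finO iS Spd.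
have rhox0 : 0 <= rhox by exact: rho_x_ge0.
have gam0 : 0 <= d_const zeta eps * lambda_max H / Lambda_min A S.
  rewrite divr_ge0 ?(ltW L0)// mulr_ge0 ?(d_const_ge0 zeps)//.
  exact/lambda_max_ge0/mean_scaled_gram_psd.
apply: le_trans (mean_x_le iT Tpd iS Spd iGT iGS lawT lawS indep eta02 Azs rz rx
  zeps Axs L0 Lle k (ltW rhoz0) rhox0 gam0) _.
rewrite -/H -/Hbar -/rhoz -/rhox lee_fin.
have := geom_conv_le rhox0 rhoz0 k0; rewrite -/rho.
set M := Num.max _ k%:R^-1; set s := geom_conv _ _ _ => sM.
have M0 : 0 < M by rewrite lt_max invr_gt0 ltr0n k0 orbT.
rewrite [leRHS]mulrDr; apply: lerD.
  by rewrite ler_wpM2r ?sqr_ge0// lerXn2r ?nnegrE ?le_max ?lexx ?rhox0 ?orbT.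
rewrite invfM.
rewrite (_ : rho ^+ k * _ = d_const zeta eps * lambda_max H / Lambda_min A S *
  l2norm (z0 - zs) ^+ 2 * (rho ^+ k / M)); last by ring.
apply: ler_wpM2l; last by rewrite ler_pdivlMr.
by rewrite mulr_ge0 ?sqr_ge0.
Qed.
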